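(* Let $K\in\mathbb{R}$, $N\in[1,\infty)$, let $(X,d,\mathfrak{m})$ be an $RCD^*(K,N)$ space and let $G\leq\mathrm{Iso}(X)$ be a closed subgroup of isometries. If there exists an orbit $G\cdot p$ ($p\in X$) with $\mathfrak{m}(G\cdot p)>0$, then $G\cdot p=X$.
   Context: A metric measure space (m.m.s.) $(X,d,\mathfrak{m})$ is a complete, separable, geodesic metric space $(X,d)$ with a Radon measure $\mathfrak{m}$ on its Borel $\sigma$-algebra, with $\mathrm{supp}\,\mathfrak{m}=X$. $\mathbb{P}_2(X)$ is the space of Borel probability measures with finite second moment, with the $L^2$-Wasserstein distance $\mathbb{W}_2$. For $\mu\in\mathbb{P}_2(X)$ put $\mathrm{Ent}_{\mathfrak{m}}(\mu)=\int\rho\log\rho\,d\mathfrak{m}$ if $\mu=\rho\mathfrak{m}$ and $(\rho\log\rho)_+$ is $\mathfrak{m}$-integrable, and $+\infty$ otherwise; $D(\mathrm{Ent}_{\mathfrak{m}})=\{\mathrm{Ent}_{\mathfrak{m}}<\infty\}$ and $\mathcal{U}_N(\mu)=\exp(-\frac1N\mathrm{Ent}_{\mathfrak{m}}(\mu))$. For $t\in[0,1]$, $\theta\geq 0$: $\sigma^{(t)}_{K/N}(\theta)=\infty$ if $K\theta^2\geq N\pi^2$; $=\frac{\sin(t\theta\sqrt{K/N})}{\sin(\theta\sqrt{K/N})}$ if $0<K\theta^2<N\pi^2$; $=t$ if $K\theta^2=0$; $=\frac{\sinh(t\theta\sqrt{-K/N})}{\sinh(\theta\sqrt{-K/N})}$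 if $K\theta^2<0$. $CD^e(K,N)$: for all $\mu_0,\mu_1\in D(\mathrm{Ent}_{\mathfrak{m}})$ there is a $\mathbb{W}_2$-geodesic $(\mu_t)_{t\in[0,1]}$ in $D(\mathrm{Ent}_{\mathfrak{m}})$ joining them with $\mathcal{U}_N(\mu_t)\geq\sigma^{(1-t)}_{K/N}(\mathbb{W}_2(\mu_0,\mu_1))\,\mathcal{U}_N(\mu_0)+\sigma^{(t)}_{K/N}(\mathbb{W}_2(\mu_0,\mu_1))\,\mathcal{U}_N(\mu_1)$ for all $t\in[0,1]$. Cheeger energy of $f\in L^2(\mathfrak{m})$: $\mathrm{Ch}_{\mathfrak{m}}(f)=\inf\{\liminf_n\frac12\int|\mathrm{Lip} f_n|^2d\mathfrak{m}\}$ over sequences of real-valued Lipschitz $f_n\to f$ in $L^2(\mathfrak{m})$, where $\mathrm{Lip} f(x)=\limsup_{y\to x}|f(x)-f(y)|/d(x,y)$ ($0$ at isolated points). $W^{1,2}(\mathfrak{m})=\{\mathrm{Ch}_{\mathfrak{m}}<\infty\}$ with norm $(\|f\|_{L^2(\mathfrak{m})}^2+2\mathrm{Ch}_{\mathfrak{m}}(f))^{1/2}$. The space is infinitesimally Hilbertian if $W^{1,2}(\mathfrak{m})$ is a Hilbert space. $(X,d,\mathfrak{m})$ is an $RCD^*(K,N)$ space if it satisfies $CD^e(K,N)$ and is infinitesimally Hilbertian (equivalent to the usual definition, by Erbar–Kuwada–Sturm). $\mathrm{Iso}(X)$ is the group of isometries of $(X,d)$ with the compact-open topology (isometries are not assumed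 to preserve $\mathfrak{m}$). *)

(* Defs.v *)
From HB Require Import structures.
From mathcomp Require Import all_boot all_order all_algebra.
From mathcomp Require Import all_classical all_reals all_analysis.

Set Implicit Arguments.
Unset Strict Implicit.
Unset Printing Implicit Defensive.

Import Order.TTheory GRing.Theory Num.Theory.
Import numFieldNormedType.Exports.

Local Open Scope classical_set_scope.
Local Open Scope ring_scope.

(* Complete metric spaces; completeType carries a base point, which only says
   that the space is nonempty. *)
#[short(type="completeMetricType")]
HB.structure Definition CompleteMetric (K : numDomainType) :=
  { T of CompletePseudoMetric K T & PseudoMetric_isMetric K T }.

Definition borel (T : ptopologicalType) := g_sigma_algebraType (@open T).

Section metric_measure_space.
Context {R : realType} {X : completeMetricType R}.
Implicit Types (m : {measure set (borel X) -> \bar R}) (f : borel X -> R).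

Definition separable := exists2 D : set X, countable D & dense D.

(* Constant-speed geodesics; only the values on [0, 1] of g matter. *)
Definition geodesic_space := forall x y : X, exists g : R -> X,
  [/\ g 0 = x, g 1 = y &
      forall s t : R, 0 <= s <= 1 -> 0 <= t <= 1 ->
        mdist (g s) (g t) = `|s - t| * mdist x y].

Definition radon m :=
  (forall x : X, exists2 U : set X, open_nbhs x U & (m U < +oo)%E) /\
  (forall A : set (borel X), measurable A ->
     m A = ereal_sup [set m K | K in [set K : set X | compact K /\ K `<=` A]]).

Definition full_support m := forall U : set X, open U -> U !=set0 -> (0 < m U)%E.

Definition metric_measure_space m :=
  [/\ separable, geodesic_space, radon m & full_support m].

Local Notation prob := (probability (borel X) R).

(* A library measure takes unconstrained values on non-measurable sets, hence
   measures are compared on Borel sets only. *)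
Definition eq_measure (mu nu : prob) :=
  forall A : set (borel X), measurable A -> mu A = nu A.

Definition P2 : set prob :=
  [set mu : prob | exists x0 : X,
     (\int[mu]_(x in [set: borel X]) ((mdist x0 (x : X)) ^+ 2)%:E < +oo)%E].

(* Since X is separable, the product sigma-algebra below is the Borel one of
   X * X. *)
Definition coupling (mu nu : prob) :
    set (probability (borel X * borel X)%type R) :=
  [set pi | forall A : set (borel X), measurable A ->
      pi (A `*` setT) = mu A /\ pi (setT `*` A) = nu A].

(* Real-valued: the infimum is finite for mu and nu in P2. *)
Definition W2 (mu nu : prob) : R :=
  Num.sqrt (fine (ereal_inf
    [set (\int[pi]_z ((@mdist R X z.1 z.2) ^+ 2)%:E)%E
      | pi in coupling mu nu])).

Definition W2_geodesic (mu0 mu1 : prob) (mu : R -> prob) :=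
  [/\ eq_measure (mu 0) mu0, eq_measure (mu 1) mu1,
      (forall t : R, 0 <= t <= 1 -> P2 (mu t)) &
      forall s t : R, 0 <= s <= 1 -> 0 <= t <= 1 ->
        W2 (mu s) (mu t) = `|s - t| * W2 mu0 mu1].

Definition density m (mu : prob) (rho : borel X -> R) :=
  [/\ measurable_fun setT rho, (forall x, 0 <= rho x) &
      forall A, measurable A -> mu A = (\int[m]_(x in A) (rho x)%:E)%E].

(* ln 0 = 0 in the library, so that 0 log 0 = 0. *)
Definition rho_log_rho (rho : borel X -> R) (x : borel X) : \bar R :=
  (rho x * ln (rho x))%:E.

Definition entropy_density m (mu : prob) (rho : borel X -> R) :=
  density m mu rho /\ m.-integrable setT (rho_log_rho rho)^\+%E.

(* The value does not depend on the density chosen by cid, as two densities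
   agree almost everywhere. *)
Definition Ent m (mu : prob) : \bar R :=
  match pselect (exists rho, entropy_density m mu rho) with
  | left e => (\int[m]_x rho_log_rho (sval (cid e)) x)%E
  | right _ => +oo%E
  end.

Definition D_Ent m : set prob := [set mu : prob | P2 mu /\ (Ent m mu < +oo)%E].

(* 0 when Ent = +oo, and +oo when Ent = -oo. *)
Definition U_ m (N : R) (mu : prob) : \bar R :=
  expeR ((- N^-1)%:E * Ent m mu)%E.

Definition sinh (x : R) : R := (expR x - expR (- x)) / 2.

Definition sigma (K N t theta : R) : \bar R :=
  if N * pi ^+ 2 <= K * theta ^+ 2 then +oo%E
  else if 0 < K * theta ^+ 2 then
    (sin (t * theta * Num.sqrt (K / N)) / sin (theta * Num.sqrt (K / N)))%:E
  else if K * theta ^+ 2 == 0 then t%:E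
  else (sinh (t * theta * Num.sqrt (- K / N)) /
        sinh (theta * Num.sqrt (- K / N)))%:E.

Definition CDe (K N : R) m :=
  forall mu0 mu1, D_Ent m mu0 -> D_Ent m mu1 ->
  exists mu : R -> prob,
    [/\ W2_geodesic mu0 mu1 mu,
        (forall t : R, 0 <= t <= 1 -> D_Ent m (mu t)) &
        forall t : R, 0 <= t <= 1 ->
          (sigma K N (1 - t) (W2 mu0 mu1) * U_ m N mu0 +
           sigma K N t (W2 mu0 mu1) * U_ m N mu1 <= U_ m N (mu t))%E].

Definition lipschitz_function (f : X -> R) :=
  exists L : R, forall x y, `|f x - f y| <= L * mdist x y.

(* The case split is needed: at an isolated point the library's limsup is -oo. *)
Definition local_lip (f : X -> R) (x : X) : \bar R :=
  if `[< open [set x] >] then 0%E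
  else limf_esup (fun y => (`|f x - f y| / mdist x y)%:E) x^'.

Definition L2cvg m (u : nat -> borel X -> R) f :=
  (fun n => 'N[m]_2%:E [EFin \o (u n \- f)%R])%E @ \oo --> 0%E.

Definition Ch m f : \bar R :=
  ereal_inf
    [set limn_einf (fun n => (2^-1)%:E * \int[m]_x (local_lip (u n) x) ^+ 2)%E
    | u in [set u : nat -> borel X -> R |
        [/\ forall n, lipschitz_function (u n),
            forall n, u n \in Lfun m 2%:E & L2cvg m u f]]].

(* Elements of L^2 and W^{1,2} are represented by functions; everything below
   only depends on their classes modulo m-a.e. equality. *)
Definition W12 m : set (borel X -> R) :=
  [set f | f \in Lfun m 2%:E /\ (Ch m f < +oo)%E].

Definition W12norm m f : R :=
  Num.sqrt (fine ('N[m]_2%:E [EFin \o f] ^+ 2 + 2%:E * Ch m f)%E).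

(* Definiteness modulo m-a.e. equality, and compatibility of b with it, follow
   from b f f being the square of the norm. *)
Definition W12_inner_product m (b : (borel X -> R) -> (borel X -> R) -> R) :=
  [/\ forall f g, W12 m f -> W12 m g -> b f g = b g f,
      forall (a : R) f g h, W12 m f -> W12 m g -> W12 m h ->
        b (fun x => a * f x + g x) h = a * b f h + b g h &
      forall f, W12 m f -> b f f = W12norm m f ^+ 2].

Definition W12_complete m :=
  forall u : nat -> borel X -> R, (forall n, W12 m (u n)) ->
    (forall e : R, 0 < e -> exists n0 : nat, forall i j,
       (n0 <= i)%N -> (n0 <= j)%N -> W12norm m (u i \- u j) < e) ->
    exists2 f, W12 m f & (fun n => W12norm m (u n \- f)) @ \oo --> (0 : R).

Definition infinitesimally_hilbertian m :=
  (exists b, W12_inner_product m b) /\ W12_complete m.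

Definition RCD_star (K N : R) m :=
  [/\ metric_measure_space m, CDe K N m & infinitesimally_hilbertian m].

End metric_measure_space.
Arguments separable {R} X.
Arguments geodesic_space {R} X.

Section isometries.
Context {R : realType} {X : completeMetricType R}.

Definition Iso : set {compact-open, X -> X} :=
  [set f | bijective f /\ forall x y : X, mdist (f x) (f y) = mdist x y].

Definition subgroup_Iso (G : set {compact-open, X -> X}) :=
  [/\ G `<=` Iso, G idfun,
      forall f g, G f -> G g -> G (f \o g) &
      forall f g, G f -> cancel f g -> G g].

(* Closed in the subspace topology that Iso inherits from the compact-open
   topology. *)
Definition closed_subgroup_Iso (G : set {compact-open, X -> X}) :=
  subgroup_Iso G /\ closed (G : set (subspace Iso)).

(* The orbit of a closed subgroup is a Borel set, so that evaluating a library
   measure on it is meaningful. *)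
Definition orbit_of (G : set {compact-open, X -> X}) (p : X) : set X :=
  [set g p | g in G].

End isometries.

(* Main.v *)
(** Let O be the orbit.  Brunn-Minkowski at time 1/2, extracted from CD^e, gives
    m (B(w, r)) <= C m (B(w, 2r/3)) at bounded scales; hence balls have finite
    measure, X is proper, and O is closed (Arzela-Ascoli in G).  If some point
    has distance rho > 0 to O, then by homogeneity every point of O is the
    starting point of a geodesic leaving O almost perpendicularly, of length
    almost rho.  So each ball of small radius s around a point of O contains a
    point at distance at least s/2 from O: the set O is porous, and porous sets
    are null for a measure doubling at small scales. *)

From HB Require Import structures.
Require Import Defs.
From mathcomp Require Import all_boot all_order all_algebra.
From mathcomp Require Import all_classical all_reals all_analysis.
From mathcomp Require Import measurable_realfun lra.
Set Implicit Arguments.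
Unset Strict Implicit.
Unset Printing Implicit Defensive.
Import Order.TTheory GRing.Theory Num.Theory.
Import numFieldNormedType.Exports.
Local Open Scope classical_set_scope.
Local Open Scope ring_scope.

(** * Borel sets of a separable metric space *)

(** The elements of [G] need not preserve [m], so [m] cannot be transported along the orbit.
    Porosity is purely metric, hence passes from one point of the orbit to all others, and the
    measure enters only through doubling, whose constant is the same around every centre. The ratio
    2/3 stands for any number strictly between 1/2 and 1: midpoints between a tiny ball around [w]
    and [B(w, r)] lie roughly in [B(w, r / 2)], and the slack absorbs the radius of the tiny ball.
    That the midpoint of two measures lives there has to be read off from the values of [W2] alone,
    with no optimal plan and no lift of a [W2]-geodesic to geodesics of [X] at hand. So near-optimal
    plans of the two halves are glued, and midpoint mass lying too far away would make these halves
    too expensive. *)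

Section borel_measurability.
Context {R : realType} {X : completeMetricType R}.

Lemma borel_open (A : set X) : open A -> measurable (A : set (borel X)).
Proof. by move=> oA; apply: sub_sigma_algebra. Qed.

Lemma borel_closed (A : set X) : closed A -> measurable (A : set (borel X)).
Proof.
move=> cA; rewrite -[A]setCK; apply/measurableC; apply: borel_open.
exact: closed_openC.
Qed.

Lemma open_mball (x : X) (r : R) : open [set y | mdist x y < r].
Proof.
rewrite openE => y /= xyr.
rewrite /interior -(@filter_from_ballE R X).
exists (r - mdist x y); first by rewrite /= subr_gt0.
rewrite ballEmdist => z /= yz.
apply: le_lt_trans (metric_triangle x y z) _.
by rewrite -ltrBrDl.
Qed.

Lemma closed_mball (x : X) (r : R) : closed [set y | mdist x y <= r].
Proof.
rewrite -openC (_ : ~` _ = [set y | r < mdist x y]); last first.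
  by apply/seteqP; split => y /=; rewrite ltNge => /negP.
rewrite openE => y /= xyr.
rewrite /interior -(@filter_from_ballE R X).
exists (mdist x y - r); first by rewrite /= subr_gt0.
rewrite ballEmdist => z /= yz.
have := metric_triangle x z y; rewrite (metric_sym z y); lra.
Qed.

Lemma measurable_mball (x : X) (r : R) :
  measurable ([set y | mdist x y < r] : set (borel X)).
Proof. by apply: borel_open; exact: open_mball. Qed.

Lemma measurable_lt_fun d (T : measurableType d) (f : T -> R) :
  (forall a, measurable [set x | f x < a]) -> measurable_fun setT f.
Proof.
move=> mf; apply: (measurability _ (RGenInftyO.measurableE R)) => _ [_ [a ->] <-].
rewrite setTI (_ : _ @^-1` _ = [set x | f x < a]); first exact: mf.
by apply/seteqP; split => x /=; rewrite in_itv.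
Qed.

Lemma measurable_mdist (x : X) :
  measurable_fun [set: borel X] (fun y : borel X => mdist x (y : X)).
Proof. by apply: measurable_lt_fun => a; exact: measurable_mball. Qed.

Lemma separable_dense_seq : separable X ->
  exists e : nat -> X, forall (x : X) (r : R), 0 < r -> exists n, mdist (e n) x < r.
Proof.
move=> [D cD dD].
have [D0|] := pfcard_geP cD.
  by have [||x []] := dD setT; [exists point | exact: openT | rewrite D0].
move=> [e]; exists e => x r r0.
have [] : ([set y | mdist x y < r] `&` D) !=set0.
  apply: dD; last exact: open_mball.
  by exists x; rewrite /= mdistxx.
move=> y [/= xy Dy].
have [n _ eny] : range e y by rewrite image_eq.
by exists n; rewrite eny metric_sym.
Qed.

(** Measurability is for the product sigma-algebra, so openness of a sublevel set in [X * X] is not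
    enough. A dense sequence writes it as a countable union of sets whose defining sum treats the
    two coordinates separately. *)
Lemma measurable_mdist2 : separable X ->
  measurable_fun [set: borel X * borel X]
    (fun z : borel X * borel X => @mdist R X z.1 z.2).
Proof.
move=> /separable_dense_seq[e dD]; apply: measurable_lt_fun => a.
rewrite (_ : [set _ | _] = \bigcup_n [set z : borel X * borel X |
   mdist (e n) (z.1 : X) + mdist (e n) (z.2 : X) < a]).
  apply: bigcupT_measurable => n.
  rewrite -[X in measurable X]setTI.
  have mf : measurable_fun [set: borel X * borel X]
     (fun z : borel X * borel X => mdist (e n) (z.1 : X) + mdist (e n) (z.2 : X)).
    apply: measurable_funD.
      by apply: measurableT_comp (measurable_mdist (e n)) _; exact: measurable_fst.
    by apply: measurableT_comp (measurable_mdist (e n)) _; exact: measurable_snd.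
  have := mf measurableT `]-oo, a[%classic (measurable_itv _).
  by congr measurable; apply/seteqP; split => z /=; rewrite in_itv.
apply/seteqP; split => [[x y]/= xya|[x y] [n _ /=] nxy].
  have [|n nx] := dD x ((a - mdist x y)/2); first lra.
  exists n => //=; have := metric_triangle (e n) x y; lra.
have := metric_triangle x (e n) y; rewrite (metric_sym x (e n)); lra.
Qed.
End borel_measurability.

(** * Marginals and gluing of couplings *)

Section marginals.
Context {R : realType}.
Local Open Scope ereal_scope.

Lemma integral_marginal d d' (T : measurableType d) (S : measurableType d')
    (mu : {measure set T -> \bar R}) (nu : {measure set S -> \bar R}) (phi : T -> S) :
  measurable_fun setT phi ->
  (forall A, measurable A -> mu (phi @^-1` A) = nu A) ->
  forall F : S -> \bar R, measurable_fun setT F -> (forall y, 0 <= F y) ->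
  \int[mu]_x F (phi x) = \int[nu]_y F y.
Proof.
move=> mphi munu F mF F0.
pose m1 : {measure set S -> \bar R} := pushforward mu phi.
rewrite (eq_measure_integral (m1 mphi)).
  have := @ge0_integral_pushforward _ _ _ _ R phi mphi mu setT F measurableT mF.
  by rewrite preimage_setT => ->.
by move=> A mA _; rewrite -munu.
Qed.

Lemma measure_probability d (T : measurableType d) (m : {measure set T -> \bar R}) :
  m setT = 1 -> exists p : probability T R, forall A, p A = m A.
Proof.
move=> m1; exists (mnormalize m (dirac point)) => A.
change ((mnormalize m (dirac point) : set T -> \bar R) A = m A).
rewrite /mnormalize; case: ifPn => [|_]; first by rewrite m1 onee_eq0.
by rewrite m1 /= invr1 mule1.
Qed.

Lemma integral_probability_cst d (T : measurableType d) (p : probability T R) (c : R) :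
  \int[p]_x c%:E = c%:E.
Proof.
by rewrite integral_cst// -[RHS]mule1; congr (_ * _); exact: probability_setT.
Qed.

Lemma pushforward_probability d d' (T : measurableType d) (S : measurableType d')
    (mu : {measure set T -> \bar R}) (phi : T -> S) :
  measurable_fun setT phi -> mu setT = 1 ->
  exists p : probability S R, forall A, p A = mu (phi @^-1` A).
Proof.
move=> mphi mu1; pose m1 : {measure set S -> \bar R} := pushforward mu phi.
by have [|p pE] := @measure_probability _ _ (m1 mphi); [|exists p].
Qed.
End marginals.

(* A gluing lemma that avoids disintegration: given the cell of [q] containing
   the middle point, the two outer points are taken independent, so the two
   copies of the middle point only share a cell. *)
Lemma glue d1 d2 d3 (T1 : measurableType d1) (T2 : measurableType d2)
    (T3 : measurableType d3) (R : realType) (pi1 : probability (T1 * T2)%type R)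
    (pi2 : probability (T2 * T3)%type R) (q : T2 -> nat) :
  (forall i, measurable (q @^-1` [set i])) ->
  (forall A, measurable A -> pi1 (setT `*` A) = pi2 (A `*` setT)) ->
  exists M : {measure set ((T1 * T2) * (T2 * T3)) -> \bar R},
  [/\ forall A, measurable A -> M (A `*` setT) = pi1 A,
      forall B, measurable B -> M (setT `*` B) = pi2 B &
      M.-negligible [set z | q z.1.2 != q z.2.1]].
Proof.
move=> mq pi12.
pose L i : set (T1 * T2) := setT `*` (q @^-1` [set i]).
pose U i : set (T2 * T3) := (q @^-1` [set i]) `*` setT.
have mL i : measurable (L i) by exact: measurableX.
have mU i : measurable (U i) by exact: measurableX.
have mQ i : measurable (L i `*` U i) by exact: measurableX.
pose n i := fine (pi1 (L i)).
have nE i : (n i)%:E = pi1 (L i) by rewrite fineK// fin_num_measure.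
have n_ge0 i : 0 <= (n i)^-1 by rewrite invr_ge0 fine_ge0.
pose P : {measure set ((T1 * T2) * (T2 * T3)) -> \bar R} := (pi1 \x pi2)%E.
(* Both plans give the middle cell [i] the mass [n i]; dividing the product by it leaves each plan
   restricted to that cell as a marginal. *)
pose Mi i := mscale (NngNum (n_ge0 i)) (mrestr P (mQ i)).
have MiE i E : Mi i E = (((n i)^-1)%:E * P (E `&` (L i `*` U i)))%E by [].
have PE (A : set (T1 * T2)) (B : set (T2 * T3)) : measurable A -> measurable B ->
  P (A `*` B) = (pi1 A * pi2 B)%E by move=> mA mB; exact: product_measure1E.
have nE' i : pi2 (U i) = (n i)%:E by rewrite nE pi12.
exists (mseries Mi 0).
(* Cells of mass 0 are included: the inverse of 0 is 0, and [a <= n i] forces [a = 0]. *)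
have cov i (a : \bar R) : (0 <= a <= (n i)%:E)%E ->
   (((n i)^-1)%:E * (a * (n i)%:E) = a)%E.
  move=> /andP[a0 an].
  have fa : a \is a fin_num.
     by rewrite ge0_fin_numE// (le_lt_trans an)// ltry.
  rewrite -(fineK fa) -!EFinM; congr EFin.
  have [n0|n0] := eqVneq (n i) 0.
    rewrite n0 mulr0 mulr0; move: a0 an; rewrite -(fineK fa) n0 !lee_fin; lra.
  by rewrite mulrCA mulVf// mulr1.
split.
- move=> A mA.
  transitivity (\sum_(0 <= i <oo) Mi i (A `*` setT))%E; first by [].
  rewrite (eq_eseriesr (g:= fun i => pi1 (A `&` L i))); last first.
    move=> i _; rewrite MiE -setXI setTI.
    rewrite PE//; last exact: measurableI.
    rewrite nE' cov// measure_ge0 /= nE.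
    by apply: le_measure; rewrite ?inE//; exact: measurableI.
  rewrite -measure_semi_bigcup//.
  + rewrite -setI_bigcupr (_ : \bigcup_i L i = setT) ?setIT//.
    by apply/seteqP; split => // -[x y] _; exists (q y).
  + by move=> i; exact: measurableI.
  + apply/trivIsetP => i j _ _ ij; apply/seteqP; split => // -[x y].
    by move=> [[_ [_ /= yi]] [_ [_ /= yj]]]; move: ij; rewrite -yi -yj eqxx.
  + by apply: bigcupT_measurable => i; exact: measurableI.
- move=> A mA.
  transitivity (\sum_(0 <= i <oo) Mi i (setT `*` A))%E; first by [].
  rewrite (eq_eseriesr (g:= fun i => pi2 (A `&` U i))); last first.
    move=> i _; rewrite MiE -setXI setTI.
    rewrite PE//; last exact: measurableI.
    rewrite -nE [X in (_ * X)%E]muleC cov// measure_ge0 /= -nE'.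
    by apply: le_measure; rewrite ?inE//; exact: measurableI.
  rewrite -measure_semi_bigcup//.
  + rewrite -setI_bigcupr (_ : \bigcup_i U i = setT) ?setIT//.
    by apply/seteqP; split => // -[x y] _; exists (q x).
  + by move=> i; exact: measurableI.
  + apply/trivIsetP => i j _ _ ij; apply/seteqP; split => // -[x y].
    by move=> [[_ [/= yi _]] [_ [/= yj _]]]; move: ij; rewrite -yi -yj eqxx.
  + by apply: bigcupT_measurable => i; exact: measurableI.
- set E := [set z | _].
  have EE : E = ~` \bigcup_i (L i `*` U i).
    apply/seteqP; split => [[[x y] [y' z]] /= qq [i _ [[_ qy] [qy' _]]]|].
      by move: qq; rewrite /E /= (qy : q y = i) (qy' : q y' = i) eqxx.
    move=> [[x y] [y' z]] /= qq; apply/eqP => /= qy; apply: qq.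
    by exists (q y) => //; split; split.
  apply/negligibleP.
    by rewrite EE; apply/measurableC/bigcupT_measurable => i.
  transitivity (\sum_(0 <= i <oo) Mi i E)%E; first by [].
  rewrite eseries0// => i _ _.
  rewrite MiE (_ : _ `&` _ = set0) ?measure0 ?mule0//.
  apply/seteqP; split => // -[[x y] [y' z]] /= [qq [[_ qy] [qy' _]]].
  by move: qq; rewrite /E /= (qy : q y = i) (qy' : q y' = i) eqxx.
Qed.

(** * The Wasserstein distance *)

(* Here [f], [h] are the lengths of the two halves of an [e]-broken path joining
   points at distance [g].  With [2 f^2 + 2 h^2 = (f - h)^2 + (f + h)^2], the
   deficit is nonnegative up to [2 e G], and at least [k^2] more when the first
   half is longer than [G / 2 + k]. *)
Lemma midpoint_ineq (R : realType) (f g h e G k : R) :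
  0 <= f -> 0 <= h -> 0 <= g -> g <= G -> 0 <= e -> 0 <= k -> g <= f + h + e ->
  g ^+ 2 <= 2 * f ^+ 2 + 2 * h ^+ 2 + 2 * e * G /\
  (G / 2 + k <= f ->
  g ^+ 2 + k ^+ 2 <= 2 * f ^+ 2 + 2 * h ^+ 2 + 2 * e * G).
Proof.
move=> f0 h0 g0 gG e0 k0 gfh.
have fh : 2 * f ^+ 2 + 2 * h ^+ 2 = (f - h) ^+ 2 + (f + h) ^+ 2 by lra.
rewrite fh.
have key : g ^+ 2 <= (f + h) ^+ 2 + 2 * e * G.
  have [ge|ge] := leP g e.
    have : g * g <= e * G by exact: ler_pM.
    have := sqr_ge0 (f + h); nra.
  have : (g - e) ^+ 2 <= (f + h) ^+ 2 by rewrite ler_sqr ?nnegrE; lra.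
  have : g * e <= G * e by rewrite ler_wpM2r.
  have := sqr_ge0 e; nra.
have fh0 := sqr_ge0 (f - h).
split; first lra.
move=> fG.
(* Either the path exceeds [g] by [k], or [h < g + k - f] and the two halves differ by more than
   [k]. *)
have [u|u] := leP (g + k) (f + h).
  have : (g + k) ^+ 2 <= (f + h) ^+ 2 by rewrite ler_sqr ?nnegrE; lra.
  have : 0 <= g * k by rewrite mulr_ge0.
  have : 0 <= e * G by rewrite mulr_ge0//; lra.
  nra.
have : k ^+ 2 <= (f - h) ^+ 2 by rewrite ler_sqr ?nnegrE; lra.
lra.
Qed.

Section transport.
Context {R : realType} {X : completeMetricType R}.
Hypothesis sX : separable X.
Implicit Types (mu nu : probability (borel X) R).
Local Open Scope ereal_scope.

Definition cost (z : borel X * borel X) : \bar R :=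
  ((@mdist R X z.1 z.2) ^+ 2)%:E.

Lemma cost_ge0 z : 0 <= cost z.
Proof. by rewrite lee_fin sqr_ge0. Qed.

Lemma measurable_cost : measurable_fun setT cost.
Proof.
by apply/measurable_EFinP; apply: measurable_funX; exact: measurable_mdist2.
Qed.

Lemma integral_coupling_fst mu nu pi (F : borel X -> \bar R) :
  coupling mu nu pi -> measurable_fun setT F -> (forall y, 0 <= F y) ->
  \int[pi]_z F z.1 = \int[mu]_x F x.
Proof.
move=> cpi mF F0; apply: integral_marginal => // A mA.
apply: etrans (cpi A mA).1; congr (pi _).
by apply/seteqP; split => [[x y]/= ?|[x y] []].
Qed.

Lemma integral_coupling_snd mu nu pi (F : borel X -> \bar R) :
  coupling mu nu pi -> measurable_fun setT F -> (forall y, 0 <= F y) ->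
  \int[pi]_z F z.2 = \int[nu]_x F x.
Proof.
move=> cpi mF F0; apply: integral_marginal => // A mA.
apply: etrans (cpi A mA).2; congr (pi _).
by apply/seteqP; split => [[x y]/= ?|[x y] []].
Qed.

Lemma W2_sqr_le mu nu pi : coupling mu nu pi ->
  ((W2 mu nu) ^+ 2)%:E <= \int[pi]_z cost z.
Proof.
move=> cpi; rewrite /W2 sqr_sqrtr; last first.
  apply: fine_ge0; apply: le_ereal_inf_tmp => _ [p _ <-].
  by apply: integral_ge0 => z _; exact: cost_ge0.
set I := ereal_inf _.
have I0 : 0 <= I.
  apply: le_ereal_inf_tmp => _ [p _ <-].
  by apply: integral_ge0 => z _; exact: cost_ge0.
have IE : I <= \int[pi]_z cost z by apply: ereal_inf_lbound; exists pi.
apply: le_trans IE; move: I0; clearbody I.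
(* If the infimum is [+oo], then [fine] turns it into 0 and the bound is trivial; no moment
   assumption is made. *)
by case: I => //= _; rewrite leey.
Qed.

Lemma product_coupling mu nu : exists2 pi, coupling mu nu pi &
  forall A B, measurable A -> measurable B -> pi (A `*` B) = mu A * nu B.
Proof.
have [|p pE] := @measure_probability R _ _ (mu \x nu).
  rewrite -setXTT [LHS]product_measure1E// -[RHS]mule1.
  by congr (_ * _); exact: probability_setT.
have pX A B : measurable A -> measurable B -> p (A `*` B) = mu A * nu B.
  by move=> mA mB; rewrite pE; exact: product_measure1E.
exists p => // A mA; rewrite !pX//.
split.
  by rewrite -[RHS]mule1; congr (_ * _); exact: probability_setT.
by rewrite -[RHS]mul1e; congr (_ * _); exact: probability_setT.
Qed.

Lemma P2_cost_finite mu nu pi : P2 mu -> P2 nu -> coupling mu nu pi ->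
  \int[pi]_z cost z < +oo.
Proof.
move=> [x0 mux] [y0 nuy] cpi.
pose D := mdist x0 y0.
pose G (a : X) (x : borel X) := ((mdist a (x : X)) ^+ 2)%:E.
have mG a : measurable_fun setT (G a).
  by apply/measurable_EFinP; apply: measurable_funX; exact: measurable_mdist.
have G0 a x : 0 <= G a x by rewrite lee_fin sqr_ge0.
(* The 3 comes from [(a + D + b)^2 <= 3 (a^2 + D^2 + b^2)], applied to the path through [x0] and
   [y0]. *)
pose F1 x := 3%R%:E * G x0 x + (3 * D ^+ 2)%R%:E.
pose F2 x := 3%R%:E * G y0 x.
have mF1 : measurable_fun setT F1.
  by apply: emeasurable_funD => //; exact: measurable_funeM.
have mF2 : measurable_fun setT F2 by exact: measurable_funeM.
have F10 x : 0 <= F1 x.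
  by apply: adde_ge0; [exact: mule_ge0|rewrite lee_fin mulr_ge0// sqr_ge0].
have F20 x : 0 <= F2 x by exact: mule_ge0.
have mF1' : measurable_fun setT (fun z : borel X * borel X => F1 z.1).
  exact: measurableT_comp.
have mF2' : measurable_fun setT (fun z : borel X * borel X => F2 z.2).
  exact: measurableT_comp.
apply: (@le_lt_trans _ _ (\int[pi]_z (F1 z.1 + F2 z.2))).
  apply: ge0_le_integral => //.
  - by move=> z _; exact: cost_ge0.
  - exact: measurable_cost.
  - exact: emeasurable_funD.
  move=> [x y] _; rewrite /cost /F1 /F2 /G -!EFinM -!EFinD lee_fin /=.
  have := metric_triangle x x0 y; have := metric_triangle x0 y0 y.
  rewrite (metric_sym x x0) -/D.
  have := mdist_ge0 x y.
  move: (mdist _ _) (mdist _ _) (mdist _ _) (mdist _ _) => a b c d d0 h1 h2.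
  have : (d ^+ 2 <= (a + (D + b)) ^+ 2)%R.
    by rewrite ler_sqr ?nnegrE//; lra.
  have := sqr_ge0 (b - a)%R; have := sqr_ge0 (b - D)%R; have := sqr_ge0 (a - D)%R.
  lra.
rewrite ge0_integralD// (integral_coupling_fst cpi)// (integral_coupling_snd cpi)//.
rewrite ge0_integralD//; last 3 first.
- by move=> x _; exact: mule_ge0.
- exact: measurable_funeM.
- by move=> x _; rewrite lee_fin mulr_ge0// sqr_ge0.
rewrite !ge0_integralZl_EFin// integral_probability_cst.
by rewrite !lte_add_pinfty// ?lte_mul_pinfty// ltry.
Qed.

(** Substitute for the existence of an optimal plan. Finite second moments make the infimum finite,
    so that [fine] does not falsify it. *)
Lemma W2_near_opt mu nu (e : R) : P2 mu -> P2 nu -> (0 < e)%R ->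
  exists2 pi, coupling mu nu pi & \int[pi]_z cost z <= (W2 mu nu ^+ 2 + e)%:E.
Proof.
move=> Pmu Pnu e0.
set S := [set \int[pi]_z cost z | pi in coupling mu nu].
have I0 : 0 <= ereal_inf S.
  apply: le_ereal_inf_tmp => _ [p _ <-].
  by apply: integral_ge0 => z _; exact: cost_ge0.
have If : ereal_inf S \is a fin_num.
  have [p cp _] := product_coupling mu nu.
  rewrite ge0_fin_numE//; apply: le_lt_trans (P2_cost_finite Pmu Pnu cp).
  by apply: ereal_inf_lbound; exists p.
have [_ [p cp <-] pS] := lb_ereal_inf_adherent e0 If.
exists p => //; apply/ltW; apply: (lt_le_trans pS).
rewrite /W2 sqr_sqrtr; last exact: fine_ge0.
by rewrite EFinD fineK.
Qed.

(** Every coupling is concentrated on the product of [A] and [B], so the independent one already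
    gives the bound. *)
Lemma W2_le mu nu (A B : set (borel X)) (G : R) :
  measurable A -> measurable B -> mu (~` A) = 0 -> nu (~` B) = 0 ->
  (0 <= G)%R -> (forall x y : X, A x -> B y -> (mdist x y <= G)%R) ->
  (W2 mu nu <= G)%R.
Proof.
move=> mA mB muA nuB G0 AB.
have [p cp pX] := product_coupling mu nu.
have : ((W2 mu nu) ^+ 2)%:E <= (G ^+ 2)%:E.
  apply: (le_trans (W2_sqr_le cp)).
  apply: (@le_trans _ _ (\int[p]_z (G ^+ 2)%:E)); last first.
    by rewrite integral_probability_cst.
  apply: ae_ge0_le_integral => //.
  - by move=> z _; exact: cost_ge0.
  - exact: measurable_cost.
  - by move=> z _; rewrite lee_fin sqr_ge0.
  - have N1 : p.-negligible (~` A `*` setT).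
      apply/negligibleP; first by apply: measurableX => //; exact: measurableC.
      exact: etrans (cp _ (measurableC mA)).1 muA.
    have N2 : p.-negligible (setT `*` ~` B).
      apply/negligibleP; first by apply: measurableX => //; exact: measurableC.
      exact: etrans (cp _ (measurableC mB)).2 nuB.
    apply: negligibleS (negligibleU N1 N2) => -[x y] /= H.
    have [Ax|Ax] := pselect (A x); last by left.
    right; split => // By; apply: H => _.
    rewrite /cost lee_fin ler_sqr ?nnegrE ?mdist_ge0//.
    exact: AB.
by rewrite lee_fin ler_sqr ?nnegrE// sqrtr_ge0.
Qed.

(** Supplies the cells for [glue]: a point is sent to the first ball of radius [e / 2] around the
    dense sequence that contains it. *)
Lemma measurable_partition (e : R) : (0 < e)%R -> exists q : X -> nat,
  (forall i, measurable (q @^-1` [set i] : set (borel X))) /\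
  forall x y, q x = q y -> (mdist x y < e)%R.
Proof.
move=> e0; have [u du] := separable_dense_seq sX.
have ex x : exists n, (mdist (u n) x < e / 2)%R by apply: du; lra.
exists (fun x => ex_minn (ex x)); split.
  move=> i; pose B j : set (borel X) := [set x | (mdist (u j) x < e / 2)%R].
  have mB j : measurable (B j) by exact: measurable_mball.
  rewrite (_ : _ @^-1` _ = B i `\` \bigcup_(j in [set j | (j < i)%N]) B j).
    by apply: measurableD => //; apply: bigcup_measurable.
  apply/seteqP; split => x /=.
    case: ex_minnP => n Bn nmin <-; split => // -[j /= jn /nmin].
    by rewrite leqNgt jn.
  case: ex_minnP => n Bn nmin [Bi Bj].
  have := nmin _ Bi; rewrite leq_eqVlt => /predU1P[//|ni].
  by exfalso; apply: Bj; exists n.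
move=> x y; case: ex_minnP => n Bn _; case: ex_minnP => m Bm _ nm.
have := metric_triangle x (u n) y; rewrite (metric_sym x (u n)).
by rewrite -nm in Bm; lra.
Qed.

(** This is [midpoint_ineq] with [G = d + r], a bound for [mdist x z]. The tolerance on [mdist y y']
    makes its error term equal to [e / 2]. If [y] is outside the ball, then [mdist x y] is at least
    [G / 2 + k], because [x] is within [d] of [w]. *)
Lemma midpoint_pointwise (w x y y' z : X) (d r k e : R) :
  (0 < d)%R -> (0 < r)%R -> (0 < k)%R -> (0 < e)%R ->
  (mdist w x < d)%R -> (mdist w z < r)%R ->
  (mdist y y' < e / (4 * (d + r)))%R ->
  (mdist x z ^+ 2 +
     k ^+ 2 * \1_(~` [set x | (mdist w x < d + (d + r) / 2 + k)%R]) y <=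
   2 * mdist x y ^+ 2 + 2 * mdist y' z ^+ 2 + e / 2)%R.
Proof.
move=> d0 r0 k0 e0 wx wz yy; set G := (d + r)%R in yy *.
have G0 : (0 < G)%R by rewrite addr_gt0.
have Ge : (2 * (e / (4 * G)) * G = e / 2)%R.
  have -> : (e / (4 * G) = e / 4 / G)%R by rewrite invfM mulrA.
  by rewrite -mulrA divfK ?gt_eqF//; lra.
have eG0 : (0 < e / (4 * G))%R by rewrite divr_gt0// mulr_gt0.
have gG : (mdist x z <= G)%R.
  by have := metric_triangle x w z; rewrite (metric_sym x w) /G; lra.
have gfh : (mdist x z <= mdist x y + mdist y' z + e / (4 * G))%R.
  by have := metric_triangle x y z; have := metric_triangle y y' z; lra.
have [] := midpoint_ineq (mdist_ge0 x y) (mdist_ge0 y' z) (mdist_ge0 x z) gG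
  (ltW eG0) (ltW k0) gfh.
rewrite Ge => K1 K2; set B := ~` _; rewrite indicE.
case: (boolP (y \in B)) => yB.
  rewrite mulr1; apply: K2; move: yB; rewrite inE /B /= => /negP; rewrite -leNgt.
  by have := metric_triangle w x y; rewrite /G; lra.
by rewrite mulr0 addr0.
Qed.

(** Integrating [midpoint_pointwise] against the glued plan, whose outer points form a coupling of
    [mu0] and [mu1], gives [D^2 + k^2 * nu B <= D^2 + e] with [D = W2 mu0 mu1], since each half
    costs about [(D / 2)^2]. Let [e] tend to 0. *)
Lemma midpoint_concentration mu0 mu1 nu (w : X) (d r k : R) :
  P2 mu0 -> P2 mu1 -> P2 nu -> (0 < d)%R -> (0 < r)%R -> (0 < k)%R ->
  mu0 (~` [set x | (mdist w x < d)%R]) = 0 ->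
  mu1 (~` [set x | (mdist w x < r)%R]) = 0 ->
  W2 mu0 nu = (W2 mu0 mu1 / 2)%R -> W2 nu mu1 = (W2 mu0 mu1 / 2)%R ->
  nu (~` [set x | (mdist w x < d + (d + r) / 2 + k)%R]) = 0.
Proof.
move=> Pmu0 Pmu1 Pnu d0 r0 k0 mu0d mu1r W0 W1.
(* Error budget: [2 * (v / 8)] for each of the two near-optimal plans and [v / 2] for the broken
   middle point. *)
have aux (u v : R) : (2 * ((u / 2) ^+ 2 + v / 8) + 2 * ((u / 2) ^+ 2 + v / 8) +
    v / 2 = u ^+ 2 + v)%R by clear; lra.
set B := ~` _.
have mB : measurable (B : set (borel X)).
  by apply: measurableC; exact: measurable_mball.
set D := W2 mu0 mu1 in W0 W1.
suff H e : (0 < e)%R -> (k ^+ 2)%:E * nu B <= e%:E.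
  have nuf : nu B \is a fin_num by exact: fin_num_measure.
  apply/eqP; rewrite eq_le measure_ge0 andbT -(fineK nuf) lee_fin.
  have k2 : (0 < k ^+ 2)%R by rewrite exprn_gt0.
  rewrite -(@pmulr_rle0 _ (k ^+ 2))//; apply/ler_addgt0Pl => e e0.
  by have := H e e0; rewrite -(fineK nuf) -EFinM lee_fin addr0.
move=> e0.
pose G := (d + r)%R.
have G0 : (0 < G)%R by rewrite addr_gt0.
have [p1 c1 I1] : exists2 pi, coupling mu0 nu pi &
    \int[pi]_z cost z <= (W2 mu0 nu ^+ 2 + e / 8)%:E.
  by apply: W2_near_opt => //; lra.
have [p2 c2 I2] : exists2 pi, coupling nu mu1 pi &
    \int[pi]_z cost z <= (W2 nu mu1 ^+ 2 + e / 8)%:E.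
  by apply: W2_near_opt => //; lra.
have eG0 : (0 < e / (4 * G))%R by rewrite divr_gt0// mulr_gt0.
have [q [mq dq]] := measurable_partition eG0.
have [|M [M1 M2 M3]] := glue (pi1 := p1) (pi2 := p2) mq.
  by move=> A mA; apply: etrans (c1 A mA).2 (esym (c2 A mA).1).
have MT : M setT = 1 by rewrite -setXTT M1//; exact: probability_setT.
pose phi (z : (borel X * borel X) * (borel X * borel X)) := (z.1.1, z.2.2).
have mphi : measurable_fun setT phi.
  by apply: measurable_fun_pair; exact: measurableT_comp.
have [p pE] := pushforward_probability mphi MT.
have cp : coupling mu0 mu1 p.
  move=> A mA; split.
    apply: etrans (c1 A mA).1; rewrite pE -M1; last exact: measurableX.
    by congr (M _); apply/seteqP; split => [[[? ?] [? ?]] [? ?]|[[? ?] [? ?]] [[]]].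
  apply: etrans (c2 A mA).2; rewrite pE -M2; last exact: measurableX.
  by congr (M _); apply/seteqP; split => [[[? ?] [? ?]] [? ?]|[[? ?] [? ?]] [? []]].
have J1 : \int[M]_z cost z.1 = \int[p1]_z cost z.
  apply: integral_marginal; [by []| |exact: measurable_cost|exact: cost_ge0].
  by move=> A mA; apply: etrans (M1 _ mA); congr (M _); apply/seteqP; split => [? ?|? []].
have J2 : \int[M]_z cost z.2 = \int[p2]_z cost z.
  apply: integral_marginal; [by []| |exact: measurable_cost|exact: cost_ge0].
  by move=> A mA; apply: etrans (M2 _ mA); congr (M _); apply/seteqP; split => [? ?|? []].
have J3 : \int[M]_z cost (phi z) = \int[p]_z cost z.
  apply: integral_marginal; [by []| |exact: measurable_cost|exact: cost_ge0].
  by move=> A mA; rewrite -pE.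
pose b (y : borel X) : \bar R := (k ^+ 2 * \1_B y)%:E.
have mb : measurable_fun setT b.
  by apply/measurable_EFinP; apply: measurable_funM => //; exact: measurable_indic.
have b0 y : 0 <= b y by rewrite lee_fin mulr_ge0// sqr_ge0.
have J4 : \int[M]_z b z.1.2 = (k ^+ 2)%:E * nu B.
  have -> : \int[M]_z b z.1.2 = \int[nu]_y b y.
    apply: (@integral_marginal _ _ _ _ _ M nu (fun z => z.1.2)) => //.
      exact: measurableT_comp.
    move=> A mA; apply: etrans (c1 A mA).2.
    apply: etrans (M1 _ (measurableX measurableT mA)).
    by congr (M _); apply/seteqP; split => [[[? ?] [? ?]] ?|[[? ?] [? ?]] [[]]].
  rewrite /b; under eq_integral do rewrite EFinM.
  rewrite ge0_integralZl_EFin//; last 2 first.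
  - by apply/measurable_EFinP; exact: measurable_indic.
  - by rewrite sqr_ge0.
  by rewrite integral_indic// setIT.
have mc1 : measurable_fun setT
    (fun z : (borel X * borel X) * (borel X * borel X) => cost z.1).
  by apply: measurableT_comp => //; exact: measurable_cost.
have mc2 : measurable_fun setT
    (fun z : (borel X * borel X) * (borel X * borel X) => cost z.2).
  by apply: measurableT_comp => //; exact: measurable_cost.
have mc3 : measurable_fun setT (cost \o phi).
  by apply: measurableT_comp => //; exact: measurable_cost.
have mb' : measurable_fun setT
    (fun z : (borel X * borel X) * (borel X * borel X) => b z.1.2).
  apply: (measurableT_comp mb); exact: measurableT_comp.
have ineq : \int[M]_z (cost (phi z) + b z.1.2) <=
    \int[M]_z (2%R%:E * cost z.1 + 2%R%:E * cost z.2 + (e / 2)%:E).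
  apply: ae_ge0_le_integral => //.
  - by move=> z _; rewrite adde_ge0// cost_ge0.
  - exact: emeasurable_funD.
  - move=> z _; apply: adde_ge0; last by rewrite lee_fin divr_ge0// ltW.
    by apply: adde_ge0; apply: mule_ge0 => //; exact: cost_ge0.
  - by repeat (apply: emeasurable_funD => //); exact: measurable_funeM.
  have N1 : M.-negligible [set z | ~ (mdist w z.1.1 < d)%R].
    pose E : set (borel X) := ~` [set x | (mdist w x < d)%R].
    have mE : measurable E by apply: measurableC; exact: measurable_mball.
    apply: (@negligibleS _ _ _ _ ((E `*` setT) `*` setT)).
      by move=> [[x y] [y' z]].
    apply/negligibleP; first by do 2 apply: measurableX => //.
    apply: etrans (M1 _ (measurableX mE measurableT)) _.
    exact: etrans (c1 _ mE).1 mu0d.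
  have N2 : M.-negligible [set z | ~ (mdist w z.2.2 < r)%R].
    pose E : set (borel X) := ~` [set x | (mdist w x < r)%R].
    have mE : measurable E by apply: measurableC; exact: measurable_mball.
    apply: (@negligibleS _ _ _ _ (setT `*` (setT `*` E))).
      by move=> [[x y] [y' z]].
    apply/negligibleP; first by do 2 apply: measurableX => //.
    apply: etrans (M2 _ (measurableX measurableT mE)) _.
    exact: etrans (c2 _ mE).2 mu1r.
  apply: negligibleS (negligibleU (negligibleU N1 N2) M3) => -[[x y] [y' z]] /= H.
  apply: contrapT => K; apply: H => _.
  have wx : (mdist w x < d)%R by apply: contrapT => ?; apply: K; left; left.
  have wz : (mdist w z < r)%R by apply: contrapT => ?; apply: K; left; right.
  have qy : q y = q y' by apply: contrapT => /eqP ?; apply: K; right.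
  have {qy dq} yy := dq _ _ qy.
  rewrite /cost /b /= -!EFinM -!EFinD lee_fin.
  exact: midpoint_pointwise.
have E1 : \int[M]_z (cost (phi z) + b z.1.2) =
    \int[p]_z cost z + (k ^+ 2)%:E * nu B.
  by rewrite ge0_integralD// ?J3 ?J4// => z _; exact: cost_ge0.
have E2 : \int[M]_z (2%R%:E * cost z.1 + 2%R%:E * cost z.2 + (e / 2)%:E) =
    2%R%:E * \int[p1]_z cost z + 2%R%:E * \int[p2]_z cost z + (e / 2)%:E.
  rewrite ge0_integralD//; last 3 first.
  - by move=> z _; apply: adde_ge0; apply: mule_ge0 => //; exact: cost_ge0.
  - by apply: emeasurable_funD; exact: measurable_funeM.
  - by move=> z _; rewrite lee_fin divr_ge0// ltW.
  rewrite ge0_integralD//; last 4 first.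
  - by move=> z _; apply: mule_ge0 => //; exact: cost_ge0.
  - exact: measurable_funeM.
  - by move=> z _; apply: mule_ge0 => //; exact: cost_ge0.
  - exact: measurable_funeM.
  rewrite !ge0_integralZl_EFin//; try by move=> z _; exact: cost_ge0.
  by rewrite J1 J2 integral_cst// MT mule1.
rewrite -(@leeD2lE _ (D ^+ 2)%:E)//.
apply: (@le_trans _ _ (\int[p]_z cost z + (k ^+ 2)%:E * nu B)).
  by rewrite leeD2r// W2_sqr_le.
rewrite -E1; apply: (le_trans ineq); rewrite E2.
apply: (@le_trans _ _ (2%R%:E * ((D / 2) ^+ 2 + e / 8)%:E +
    2%R%:E * ((D / 2) ^+ 2 + e / 8)%:E + (e / 2)%:E)).
  rewrite W0 in I1; rewrite W1 in I2.
  by apply: leeD => //; apply: leeD; apply: lee_wpmul2l.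
by rewrite -!EFinM -!EFinD lee_fin aux.
Qed.
End transport.

(** * Entropy and the distortion coefficients *)

Section entropy.
Context {R : realType} {X : completeMetricType R}.
Context (m : {measure set (borel X) -> \bar R}).
Implicit Types (mu : probability (borel X) R) (rho : borel X -> R).
Local Open Scope ereal_scope.

Lemma measurable_rho_log_rho rho :
  measurable_fun setT rho -> measurable_fun setT (rho_log_rho rho).
Proof.
move=> mrho; apply/measurable_EFinP; apply: measurable_funM => //.
by apply: measurableT_comp => //; exact: measurable_ln.
Qed.

Lemma density_integrable mu rho :
  density m mu rho -> m.-integrable setT (EFin \o rho).
Proof.
move=> [mrho rho0 muE]; apply/integrableP; split; first exact/measurable_EFinP.
under eq_integral => x _ do rewrite /= ger0_norm//.
by rewrite -muE// (le_lt_trans (probability_le1 _ _))// ltry.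
Qed.

Lemma integrable_indic_lty (S : set (borel X)) : measurable S -> m S < +oo ->
  m.-integrable setT (EFin \o \1_S).
Proof.
move=> mS Sf; apply/integrableP; split.
  by apply/measurable_EFinP; exact: measurable_indic.
under eq_integral => x _ do rewrite /= ger0_norm//.
by rewrite integral_indic// setIT.
Qed.

Lemma EntE mu rho : entropy_density m mu rho ->
  Ent m mu = \int[m]_x rho_log_rho rho x.
Proof.
move=> erho; rewrite /Ent; case: pselect => [e|[]]; last by exists rho.
case: cid => /= rho' [drho' _]; case: erho => drho _.
have mrho := measurable_rho_log_rho (let: And3 h _ _ := drho in h).
have mrho' := measurable_rho_log_rho (let: And3 h _ _ := drho' in h).
apply: ae_eq_integral => //.
have H : ae_eq m setT (EFin \o rho') (EFin \o rho).
  apply: integral_ae_eq => //; first exact: density_integrable drho'.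
    by apply/measurable_EFinP; case: drho.
  move=> E _ mE; case: drho => _ _ /(_ E mE) <-.
  by case: drho' => _ _ /(_ E mE) <-.
apply: filterS H => x /= /(_ Logic.I) [] rr _.
by rewrite /rho_log_rho rr.
Qed.

(* The tangent line of [x ln x] at [a]; this replaces Jensen's inequality. *)
Lemma mulr_ln_ge (x a : R) : (0 <= x)%R -> (0 < a)%R ->
  (x * (ln a + 1) - a <= x * ln x)%R.
Proof.
rewrite le_eqVlt => /predU1P[<- a0|x0 a0]; first by rewrite !mul0r; lra.
have ax0 : (0 < a / x)%R by rewrite divr_gt0.
have : (ln (a / x) <= a / x - 1)%R.
  by have := @le_ln1Dx R (a / x - 1); rewrite addrCA subrr addr0; apply; lra.
rewrite ln_div ?posrE// => H.
have : (x * (ln a - ln x) <= x * (a / x - 1))%R by rewrite ler_pM2l.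
rewrite [X in (_ <= X)%R -> _]mulrBr mulrCA divff ?gt_eqF//; lra.
Qed.

(** Integrating the tangent line of [x ln x] at [a = 1 / v] gives [ln a + 1 - a * m S], and
    [a * m S <= 1]. *)
Lemma Ent_ge mu (S : set (borel X)) (v : R) :
  measurable S -> mu (~` S) = 0 -> (0 < v)%R -> m S <= v%:E ->
  (- ln v)%:E <= Ent m mu.
Proof.
move=> mS muS v0 Sv; rewrite /Ent; case: pselect => [e|]; last by rewrite leey.
case: cid => /= rho [drho _].
have irho := density_integrable drho.
case: drho => mrho rho0 muE.
pose a := (v^-1)%R.
have a0 : (0 < a)%R by rewrite invr_gt0.
have Sf : m S < +oo by rewrite (le_lt_trans Sv)// ltry.
have iS : m.-integrable setT (fun x => (a * \1_S x)%:E).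
  have := @integrableZl _ _ _ m setT measurableT a _ (integrable_indic_lty mS Sf).
  by apply: eq_integrable => // x _; rewrite EFinM.
(* The constant term is cut off to [S], as [m] may be infinite outside; there [rho] vanishes almost
   everywhere and the inequality reads [0 <= 0]. *)
pose g x := (rho x * (ln a + 1))%:E - (a * \1_S x)%:E.
have ir : m.-integrable setT (fun x => (rho x * (ln a + 1))%:E).
  have := @integrableZl _ _ _ m setT measurableT (ln a + 1)%R _ irho.
  by apply: eq_integrable => // x _; rewrite /= mulrC EFinM.
have ig : m.-integrable setT g by exact: integrableB.
have rhoS : {ae m, forall x, (~` S) x -> rho x = 0%R}.
  have : ae_eq m (~` S) (EFin \o rho) (cst 0).
    apply/ae_eq_integral_abs; first exact: measurableC.
      by apply: measurable_funTS; exact/measurable_EFinP.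
    under eq_integral => x _ do rewrite /= ger0_norm//.
    by rewrite -muE ?muS//; exact: measurableC.
  by apply: filterS => x /= H Sx; have [] := H Sx.
have gf : {ae m, forall x, g x <= rho_log_rho rho x}.
  apply: filterS rhoS => x H; rewrite /g /rho_log_rho -EFinB lee_fin indicE.
  case: (boolP (x \in S)) => xS; first by rewrite mulr1; exact: mulr_ln_ge.
  rewrite H; last by rewrite notin_setE in xS.
  by rewrite !mul0r mulr0 subrr.
have mf := measurable_rho_log_rho mrho.
have mg := measurable_int _ ig.
apply: (@le_trans _ _ (\int[m]_x g x)).
  rewrite integralB//.
  have -> : \int[m]_x (rho x * (ln a + 1))%:E = (ln a + 1)%:E.
    under eq_integral do rewrite mulrC EFinM.
    rewrite integralZl// -muE// -[RHS]mule1; congr (_ * _).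
    exact: probability_setT.
  have -> : \int[m]_x (a * \1_S x)%:E = a%:E * m S.
    under eq_integral do rewrite EFinM.
    by rewrite integralZl ?integral_indic ?setIT//; exact: integrable_indic_lty.
  have Sfin : m S \is a fin_num by rewrite ge0_fin_numE.
  rewrite -(fineK Sfin) -EFinM -EFinB lee_fin /a lnV ?posrE//.
  have : (v^-1 * fine (m S) <= v^-1 * v)%R.
    by rewrite ler_pM2l ?invr_gt0// -lee_fin fineK.
  by rewrite mulVf ?gt_eqF//; lra.
have E f : \int[m]_x f x = \int[m]_x f^\+ x - \int[m]_x f^\- x by exact: integralE.
rewrite (E (rho_log_rho rho)) (E g) leeB//.
- apply: ae_ge0_le_integral => //; try exact: measurable_funepos.
  by apply: filterS gf => x gfx _; rewrite !funeposE ge_max !le_max gfx lexx orbT.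
- apply: ae_ge0_le_integral => //; try exact: measurable_funeneg.
  by apply: filterS gf => x gfx _; rewrite !funenegE ge_max !le_max leeN2 gfx lexx orbT.
Qed.

(** Equality case of [Ent_ge]. The last clause gives a finite second moment as soon as [A] is
    bounded. *)
Lemma uniform_probability (A : set (borel X)) : measurable A ->
  0 < m A -> m A < +oo -> exists mu : probability (borel X) R,
  [/\ mu (~` A) = 0, Ent m mu = (- ln (fine (m A)))%:E &
   forall (w : X) (r : R), (forall x : X, A x -> (mdist w x <= r)%R) -> P2 mu].
Proof.
move=> mA A0 Af.
have fA : m A \is a fin_num by rewrite ge0_fin_numE// ltW.
have a0 : (0 < fine (m A))%R by rewrite fine_gt0// A0.
set a := fine (m A) in a0 *.
have aE : m A = a%:E by rewrite fineK.
have ai0 : (0 <= a^-1)%R by rewrite invr_ge0 ltW.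
pose m0 : {measure set (borel X) -> \bar R} := mscale (NngNum ai0) (mrestr m mA).
have m0E B : m0 B = (a^-1)%:E * m (B `&` A) by [].
have [|mu muE] := @measure_probability _ _ _ m0.
  by rewrite m0E setTI aE -EFinM mulVf// gt_eqF.
pose rho (x : borel X) := (a^-1 * \1_A x)%R.
have mrho : measurable_fun setT rho.
  by apply: measurable_funM => //; exact: measurable_indic.
have muA : mu (~` A) = 0 by rewrite muE m0E setICl measure0 mule0.
have rE x : rho_log_rho rho x = (a^-1 * ln a^-1)%:E * (\1_A x)%:E.
  rewrite /rho_log_rho /rho -EFinM indicE.
  by case: (boolP (x \in A)) => xA; rewrite ?mulr1// !mulr0 mul0r.
have ir : m.-integrable setT (rho_log_rho rho).
  have := @integrableZl _ _ _ m setT measurableT (a^-1 * ln a^-1)%R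
    _ (integrable_indic_lty mA Af).
  by apply: eq_integrable => // x _; rewrite rE.
have drho : density m mu rho.
  split=> //; first by move=> x; rewrite mulr_ge0.
  move=> B mB; rewrite muE m0E; under eq_integral do rewrite EFinM.
  rewrite ge0_integralZl_EFin//; last first.
    by apply: measurable_funTS; apply/measurable_EFinP; exact: measurable_indic.
  by rewrite integral_indic// setIC.
exists mu; split => //.
  rewrite (@EntE mu rho); last by split => //; exact: integrable_funepos.
  under eq_integral do rewrite rE.
  rewrite integralZl//; last exact: integrable_indic_lty.
  rewrite integral_indic// setIT aE -EFinM mulrAC mulVf ?gt_eqF// mul1r.
  by rewrite lnV.
move=> w r Ar; exists w; apply: (@le_lt_trans _ _ (\int[mu]_x (r ^+ 2)%:E)).
  apply: ae_ge0_le_integral => //.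
  - by move=> x _; rewrite lee_fin sqr_ge0.
  - by apply/measurable_EFinP; apply: measurable_funX; exact: measurable_mdist.
  - by move=> x _; rewrite lee_fin sqr_ge0.
  exists (~` A); split => //; first exact: measurableC.
  move=> x /= H Ax; apply: H => _; rewrite lee_fin.
  have := Ar _ Ax; have := mdist_ge0 w x => d0 dr.
  by rewrite ler_sqr ?nnegrE//; exact: le_trans dr.
by rewrite integral_probability_cst ltry.
Qed.

Lemma U_uniform (N : R) mu (v : R) : Ent m mu = (- ln v)%:E ->
  U_ m N mu = (expR (N^-1 * ln v))%:E.
Proof. by move=> E; rewrite /U_ E -EFinM /= mulrNN. Qed.

Lemma U_le (N : R) mu (S : set (borel X)) (v : R) : (0 < N)%R ->
  measurable S -> mu (~` S) = 0 -> (0 < v)%R -> m S <= v%:E ->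
  U_ m N mu <= (expR (N^-1 * ln v))%:E.
Proof.
move=> N0 mS muS v0 Sv; have H := Ent_ge mS muS v0 Sv.
rewrite /U_ -[leRHS]/(expeR (N^-1 * ln v)%:E) lee_expeR.
rewrite -[(N^-1 * ln v)%R]mulrNN EFinM.
rewrite EFinN !mulNe leeN2; apply: lee_wpmul2l => //.
by rewrite lee_fin invr_ge0 ltW.
Qed.
End entropy.

(* From [sin (y / 2) / sin y = 1 / (2 cos (y / 2))] and its hyperbolic analogue. *)
Lemma sigma_half_ge (R : realType) (K N L theta : R) : 1 <= N -> 0 <= theta <= L ->
  ((expR (- (L * Num.sqrt (`|K| / N) + 1)))%:E <= sigma K N (2^-1) theta)%E.
Proof.
move=> N1 /andP[t0 tL].
have N0 : 0 < N by lra.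
set s := L * _.
have s0 : 0 <= s by rewrite mulr_ge0 ?sqrtr_ge0//; lra.
(* The [+ 1] in the exponent pays for a factor 1/2, as [2 <= s + 2 <= expR (s + 1)]; if [K >= 0] the
   coefficient is itself at least 1/2. *)
have half : expR (- (s + 1)) <= 2^-1.
  rewrite expRN lef_pV2 ?posrE ?expR_gt0//.
  by apply: le_trans (expR_ge1Dx (s + 1)); lra.
rewrite /sigma; case: ifPn => [_|]; first by rewrite leey.
rewrite -ltNge => h1; case: ifPn => [h2|h2].
  have K0 : 0 < K.
    rewrite ltNge; apply/negP => K0; have := sqr_ge0 theta; nra.
  have th : 0 < theta.
    by rewrite lt0r t0 andbT; apply/eqP => th; rewrite th expr0n/= mulr0 ltxx in h2.
  set y := theta * _.
  have y0 : 0 < y by rewrite mulr_gt0// sqrtr_gt0 divr_gt0.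
  have ypi : y < pi.
    rewrite -(@ltr_pXn2r _ 2) ?nnegrE ?pi_ge0 ?ltW//.
    rewrite exprMn sqr_sqrtr ?divr_ge0 ?ltW//.
    by rewrite mulrA ltr_pdivrMr// mulrC [X in _ < X]mulrC.
  have -> : 2^-1 * theta * Num.sqrt (K / N) = y / 2 by rewrite -mulrA mulrC.
  have c0 : 0 < cos (y / 2) by apply: cos_gt0_pihalf; lra.
  have s20 : 0 < sin (y / 2) by apply: sin_gt0_pi; lra.
  have -> : sin y = 2 * sin (y / 2) * cos (y / 2).
    by rewrite [in LHS](splitr y) sinD; lra.
  rewrite lee_fin; apply: (le_trans half).
  have -> : sin (y / 2) / (2 * sin (y / 2) * cos (y / 2)) = 2^-1 * (cos (y / 2))^-1.
    by rewrite !invfM !mulrA (mulrAC (sin _)) divff ?gt_eqF// mul1r.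
  rewrite -[leLHS]mulr1 ler_pM2l//.
  by rewrite -[leLHS]invr1 lef_pV2 ?posrE// cos_le1.
case: ifPn => h3; first by rewrite lee_fin.
have th : 0 < theta.
  by rewrite lt0r t0 andbT; apply/eqP => th; rewrite th expr0n/= mulr0 eqxx in h3.
have K0 : K < 0.
  have : K * theta ^+ 2 < 0 by rewrite lt_neqAle h3 leNgt.
  by rewrite pmulr_llt0// exprn_gt0.
set y := theta * _.
have y0 : 0 < y by rewrite mulr_gt0// sqrtr_gt0 divr_gt0// oppr_gt0.
have ys : y <= s by rewrite /s /y (ler0_norm (ltW K0)) ler_wpM2r// sqrtr_ge0.
have -> : 2^-1 * theta * Num.sqrt (- K / N) = y / 2 by rewrite -mulrA mulrC.
set E := expR (y / 2).
have E1 : 1 < E by rewrite expR_gt1; lra.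
have Ei : expR (- (y / 2)) = E^-1 by rewrite expRN.
have Ey : expR y = E * E by rewrite -expRD -splitr.
have Eiy : expR (- y) = E^-1 * E^-1 by rewrite expRN Ey invfM.
have EE : E * E^-1 = 1 by rewrite divff// gt_eqF//; lra.
have Ei1 : E^-1 < 1 by rewrite invf_lt1; lra.
have Ei0 : 0 < E^-1 by rewrite invr_gt0; lra.
rewrite lee_fin /sinh Ei Ey Eiy ler_pdivlMr; last first.
  rewrite divr_gt0// subr_gt0; nra.
have sE : expR (- (s + 1)) <= 2^-1 * E^-1.
  rewrite opprD expRD mulrC ler_pM ?expR_ge0//.
    rewrite expRN lef_pV2 ?posrE ?expR_gt0//.
    by apply: le_trans (expR_ge1Dx 1); lra.
  by rewrite -Ei ler_expR; lra.
apply: (le_trans (y := 2^-1 * E^-1 * ((E * E - E^-1 * E^-1) / 2))).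
  by rewrite ler_wpM2r//; nra.
set F := E^-1 in EE Ei1 Ei0 *.
have -> : E * E - F * F = (E - F) * (E + F) by lra.
have -> : 2^-1 * F * ((E - F) * (E + F) / 2) = (E - F) / 2 * ((E * F + F * F) / 2) by lra.
have : F * F <= 1 by nra.
have : 0 < (E - F) / 2 by lra.
rewrite EE => p1 p2.
rewrite -[leRHS]mulr1 ler_pM2l//; lra.
Qed.

(** * Properness and closed orbits *)

(** A family of maximal size works: a point of [A] not covered by it could be added. *)
Lemma separated_cover (R : realType) (X : metricType R) (A : set X) (e : R) (n : nat) :
  (forall s : seq X, pairwise (fun x y => e <= mdist x y) s ->
     (forall x, x \in s -> A x) -> (size s <= n)%N) ->
  exists s : seq X, [/\ pairwise (fun x y => e <= mdist x y) s,
    forall x, x \in s -> A x &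
    forall y, A y -> exists2 x, x \in s & mdist x y < e].
Proof.
move=> bound.
pose P k := `[< exists s : seq X, [/\ size s = k,
  pairwise (fun x y => e <= mdist x y) s & forall x, x \in s -> A x] >].
have P0 : exists k, P k by exists 0%N; apply/asboolP; exists [::].
have Pn k : P k -> (k <= n)%N by move=> /asboolP[s [<- ps sA]]; exact: bound.
case: (ex_maxnP P0 Pn) => k /asboolP[s [sk ps sA]] kmax.
exists s; split => // y Ay; apply: contrapT => ny.
suff /kmax : P k.+1 by rewrite ltnn.
apply/asboolP; exists (y :: s); split; first by rewrite /= sk.
  rewrite pairwise_cons ps andbT; apply/allP => x xs.
  by rewrite leNgt; apply/negP => yx; apply: ny; exists x => //; rewrite metric_sym.
by move=> x; rewrite in_cons => /predU1P[->//|]; exact: sA.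
Qed.

Section topology.
Context {R : realType} {X : completeMetricType R}.

Lemma ultra_fmap T U (f : T -> U) (F : set_system T) :
  UltraFilter F -> UltraFilter (f @ F).
Proof.
move=> FU; split; first exact: fmap_proper_filter.
move=> G PG FG; apply/seteqP; split=> // A GA.
have [//|FA] := in_ultra_setVsetC (f @^-1` A) FU.
have GA' : G (~` A) by exact: FG.
by have [x []] := filter_ex (filterI GA GA').
Qed.

(** An ultrafilter containing [A] contains a ball of each finite cover, since otherwise it would
    contain the complements of all of them; so it is Cauchy. *)
Lemma complete_totally_bounded_compact (A : set X) : closed A ->
  (forall e : R, 0 < e -> exists s : seq X,
     forall y, A y -> exists2 x, x \in s & mdist x y < e) ->
  compact A.
Proof.
move=> cA tb; rewrite compact_ultra => F FU FA.
have cF : cauchy F.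
  apply/cauchy_exP => e e0; have [s sA] := tb e e0.
  apply: contrapT => nF.
  have : F (A `&` [set y | forall x, x \in s -> ~ ball x e y]).
    apply: filterI => //; elim: s {sA} => [|a s IH].
      by apply: filterS filterT => y _ x; rewrite in_nil.
    have [Fa|Fa] := in_ultra_setVsetC (ball a e) FU; first by exfalso; apply: nF; exists a.
    apply: filterS (filterI Fa IH) => y [ya ys] x; rewrite in_cons => /predU1P[->//|].
    exact: ys.
  move=> /filter_ex[y [/sA[x xs xy] /(_ x xs)]].
  by rewrite ballEmdist.
have Fl : cvg F by exact: cauchy_cvg.
exists (lim F); split => //=.
exact: (@closed_cvg _ _ F _ id A cA FA _ Fl).
Qed.

Lemma cvg_mdist T (F : set_system T) (f : T -> X) (y : X) : Filter F ->
  f @ F --> y -> forall e : R, 0 < e -> F [set t | mdist y (f t) < e].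
Proof. by move=> FF /metricType_numDomainType.cvgrPdist_lt. Qed.

Lemma mdist_eq (x y : X) : (forall e : R, 0 < e -> mdist x y < 2 * e) -> x = y.
Proof.
move=> H; apply: mdist_positivity; apply/eqP; rewrite eq_le mdist_ge0 andbT.
apply/ler_addgt0Pl => e e0; have := H (e / 2); lra.
Qed.

(** Take an ultrafilter of elements [g] of [G] with [g p] tending to [y]. Then [g x] stays in a
    closed ball around [y], compact by properness, so all pointwise limits exist at once. The
    inverses are passed to the limit as well, because a limit of surjective isometries might fail to
    be onto. *)
Lemma orbit_closed (G : set {compact-open, X -> X}) (p : X) :
  (forall (x : X) (r : R), compact [set y | mdist x y <= r]) ->
  closed_subgroup_Iso G -> closed (orbit_of G p).
Proof.
move=> prop [[GI G1 GM GV] Gcl] y yG.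
have Giso g a b : G g -> mdist (g a) (g b) = mdist a b by move=> /GI[].
have /choice[J JP] (g : X -> X) : exists j : X -> X,
    G g -> [/\ G j, cancel g j & cancel j g].
  have [Gg|] := pselect (G g); last by exists idfun.
  by have [[j gj jg] _] := GI _ Gg; exists j => _; split => //; exact: GV Gg gj.
pose B (e : R) : set (X -> X) := [set g | G g /\ mdist y (g p) < e].
pose F0 := filter_from [set e : R | 0 < e] B.
have F0P : ProperFilter F0.
  apply: filter_from_proper; last first.
    move=> e e0; have [z [[g Gg <-] yz]] := yG _ (nbhsx_ballx y (PosNum e0)%:num e0).
    by rewrite ballEmdist in yz; exists g.
  apply: filter_from_filter; first by exists 1; rewrite /= ltr01.
  move=> e f e0 f0; exists (Num.min e f); first by rewrite /= lt_min e0.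
  by move=> g [Gg]; rewrite lt_min => /andP[]; split.
have [U [UU F0U]] := ultraFilterLemma F0P.
have UB e : 0 < e -> U (B e) by move=> e0; apply: F0U; exists e.
have UG : U G by apply: filterS (UB 1 ltr01) => g [].
have lim_of (f : (X -> X) -> X) (a : X) (r : R) :
    U [set g | mdist a (f g) <= r] ->
    exists l : X, (f @ U : set_system X) --> l.
  move=> Ur; have := prop a r; rewrite compact_ultra.
  by move=> /(_ _ (ultra_fmap f UU) Ur)[l [_ ?]]; exists l.
have /choice[h hP] (x : X) : exists l : X, (fun g : X -> X => g x) @ U --> l.
  apply: (lim_of _ y (1 + mdist p x)); apply: filterS (UB 1 ltr01) => g [Gg yg] /=.
  by have := metric_triangle y (g p) (g x); rewrite (Giso g)//; lra.
have /choice[k kP] (x : X) : exists l : X, (fun g : X -> X => J g x) @ U --> l.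
  apply: (lim_of _ p (1 + mdist y x)); apply: filterS (UB 1 ltr01) => g [Gg yg] /=.
  have [_ _ Jg] := JP _ Gg; rewrite -(Giso g)// Jg.
  by have := metric_triangle (g p) y x; rewrite (metric_sym (g p) y); lra.
have hiso a b : mdist (h a) (h b) = mdist a b.
  apply/eqP; rewrite -subr_eq0 -normr_le0; apply/ler_addgt0Pl => e e0; rewrite addr0.
  have e20 : 0 < e / 2 by rewrite divr_gt0.
  have [g [[Gg ga] gb]] := filter_ex
    (filterI (filterI UG (cvg_mdist _ (hP a) e20)) (cvg_mdist _ (hP b) e20)).
  rewrite /= in ga gb.
  rewrite ler_norml -(Giso g a b)//.
  have := metric_triangle (h a) (g a) (h b).
  have := metric_triangle (g a) (g b) (h b).
  have := metric_triangle (g a) (h a) (g b).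
  have := metric_triangle (h a) (h b) (g b).
  rewrite (metric_sym (g a) (h a)) (metric_sym (g b) (h b)) => *.
  by apply/andP; split; lra.
have hk : cancel k h.
  move=> x; apply: mdist_eq => e e0.
  have [g [[Gg ga] gb]] := filter_ex
    (filterI (filterI UG (cvg_mdist _ (hP (k x)) e0)) (cvg_mdist _ (kP x) e0)).
  rewrite /= in ga gb; have [_ _ Jg] := JP _ Gg.
  rewrite -(Giso g)// Jg in gb.
  by have := metric_triangle (h (k x)) (g (k x)) x; lra.
have kh : cancel h k.
  move=> x; apply: mdist_eq => e e0.
  have [g [[Gg ga] gb]] := filter_ex
    (filterI (filterI UG (cvg_mdist _ (kP (h x)) e0)) (cvg_mdist _ (hP x) e0)).
  rewrite /= in ga gb; have [_ gJ Jg] := JP _ Gg.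
  rewrite -(Giso g)// Jg in ga.
  have := metric_triangle (k (h x)) (J g (h x)) x.
  rewrite -[mdist (J g _) x](Giso g)// -[mdist (k _) (J g _)](Giso g)// Jg; lra.
have hp : h p = y.
  apply: mdist_eq => e e0.
  have [g [[Gg ga] gb]] := filter_ex (filterI (UB e e0) (cvg_mdist _ (hP p) e0)).
  by have := metric_triangle (h p) (g p) y; rewrite (metric_sym (g p) y) /= in gb *; lra.
exists h => //.
have hI : Iso h by split => //; exists k.
(* [G] is closed relative to [Iso] only, which is why [h] had to be shown to be a bijective isometry
   first. *)
move: (Gcl) => /closed_subspaceP[V cV VG].
suff : (V `&` Iso) h by rewrite VG => -[].
split => //.
have UV : U V.
  apply: filterS UG => g Gg.
  by have [] : (V `&` Iso) g by rewrite VG; split => //; exact: GI.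
have hc : continuous h.
  move=> x; apply/metricType_numDomainType.cvgrPdist_lt => e e0.
  near=> z; rewrite hiso; near: z.
  by apply/metricType_numDomainType.nbhs_mdistP; exists e.
(* Isometries are equicontinuous, so pointwise convergence becomes uniform on compact sets, which is
   compact-open convergence to the continuous map [h]. *)
have Uh : {compact-open, U --> h}.
  apply/compact_open_fam_compactP => //; apply/pointwise_compact_cvg.
    apply/near_powerset_filter_fromP; first exact: equicontinuous_subset_id.
    exists G => // x E; rewrite -entourage_ballE => -[e /= e0 eE].
    near=> z => g Gg; apply: eE; rewrite /= ballEmdist /= Giso//; near: z.
    by apply/metricType_numDomainType.nbhs_mdistP; exists e.
  by apply/pointwise_cvgP.
exact: (@closed_cvg _ {compact-open, X -> X} U _ id V cV UV _ Uh).
Unshelve. all: by end_near. Qed.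
End topology.

(** * Doubling and porosity *)

Section finite_families.
Context {R : realType} d (T : measurableType d) (m : {measure set T -> \bar R}).
Local Open Scope ereal_scope.

Lemma measure_le_sum_cover (I : eqType) (f : I -> set T) (s : seq I) (A : set T) :
  measurable A -> (forall i, measurable (f i)) ->
  (forall y, A y -> exists2 i, i \in s & f i y) ->
  m A <= \sum_(i <- s) m (f i).
Proof.
move=> + mf; elim: s A => [|i s IH] A mA cov.
  rewrite big_nil (_ : A = set0) ?measure0//.
  by apply/seteqP; split => // y /cov[].
rewrite big_cons -(setUIDK A (f i)).
rewrite (le_trans (measureU2 _ _ _))//; try by [exact: measurableI|exact: measurableD].
apply: leeD; last first.
  apply: IH; first exact: measurableD.
  move=> y [/cov[j]]; rewrite in_cons => /predU1P[->|js jy _]; first by [].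
  by exists j.
by apply: le_measure; rewrite ?inE//; exact: measurableI.
Qed.

Lemma sum_disjoint_le_measure (I : eqType) (f : I -> set T) (s : seq I) (A : set T) :
  measurable A -> (forall i, measurable (f i)) ->
  pairwise (fun i j => `[< f i `&` f j = set0 >]) s ->
  (forall i, i \in s -> f i `<=` A) ->
  \sum_(i <- s) m (f i) <= m A.
Proof.
move=> + mf; elim: s A => [|i s IH] A mA; first by rewrite big_nil.
rewrite pairwise_cons => /andP[/allP is_ ps] sA.
rewrite big_cons -(@setDUK _ (f i) A); last by apply: sA; rewrite mem_head.
rewrite measureU//; last 2 first.
- exact: measurableD.
- by apply/seteqP; split => // y [? []].
apply: leeD => //; apply: IH => //; first exact: measurableD.
move=> j js y jy; split; first by apply: (sA j) => //; rewrite in_cons js orbT.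
move=> iy; have /asboolP ij := is_ j js.
have : (f i `&` f j) y by [].
by rewrite ij.
Qed.
End finite_families.

Section doubling.
Context {R : realType} {X : completeMetricType R}.
Context (m : {measure set (borel X) -> \bar R}) (K N : R).
Hypotheses (N1 : 1 <= N) (mm : metric_measure_space m) (cd : CDe K N m).

Let sX : separable X. Proof. by case: mm. Qed.

Definition mball (x : X) (r : R) : set (borel X) := [set y | mdist x y < r].

Lemma mball_measurable x r : measurable (mball x r).
Proof. exact: measurable_mball. Qed.

Lemma sub_mball x y (r s : R) : mdist x y + r <= s -> mball y r `<=` mball x s.
Proof.
by rewrite /mball => xyr z /= yz; have := metric_triangle x y z; lra.
Qed.

Lemma mball_gt0 x (r : R) : 0 < r -> (0 < m (mball x r))%E.
Proof.
move=> r0; case: mm => _ _ _; apply; first exact: open_mball.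
by exists x; rewrite /mball/= mdistxx.
Qed.

Lemma mball_locally_finite x : exists2 r : R, 0 < r & (m (mball x r) < +oo)%E.
Proof.
case: mm => _ _ [/(_ x)[U [oU Ux] mU] _] _.
have : nbhs x U by exact: open_nbhs_nbhs.
move=> /metricType_numDomainType.nbhs_mdistP[r /= r0 rU]; exists r => //.
apply: le_lt_trans mU; apply: le_measure; rewrite ?inE.
- exact: mball_measurable.
- exact: borel_open.
- exact: rU.
Qed.

Lemma compact_measure_lty (A : set X) : compact A -> (m A < +oo)%E.
Proof.
move=> /[dup] /(compact_closed (@metric_hausdorff R X)) cA0; rewrite compact_cover => cA.
have /choice[r rP] x : exists r : R, 0 < r /\ (m (mball x r) < +oo)%E.
  by have [r r0 mr] := mball_locally_finite x; exists r.
have [||D _ AD] := cA X setT (fun x => mball x (r x)).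
- by move=> x _; exact: open_mball.
- by move=> x _; exists x => //; rewrite /mball/= mdistxx; case: (rP x).
apply: (@le_lt_trans _ _ (\sum_(x <- finmap.enum_fset D) m (mball x (r x)))%E).
  apply: (@measure_le_sum_cover _ _ _ m _ (fun x : X => mball x (r x))).
  + exact: borel_closed.
  + by move=> x; exact: mball_measurable.
  + by move=> y /AD[x xD xy]; exists x.
by apply: lte_sum_pinfty => x _; case: (rP x).
Qed.

(* Join the uniform probability on a tiny ball around [w] to the one on [A] and
   evaluate CD^e at the midpoint, which lives on the smaller ball; the term of
   the tiny ball is dropped. *)
Lemma CDe_ball (L : R) (w : X) (r : R) (A : set (borel X)) :
  0 < r -> 2 * r <= L -> measurable A -> A `<=` mball w r -> (m A < +oo)%E ->
  (m A <= (expR (N * (L * Num.sqrt (`|K| / N) + 1)))%:E * m (mball w (2 / 3 * r)))%E.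
Proof.
move=> r0 rL mA Aw Af.
set C := expR _; set V := m (mball w _).
have V0 : (0 < V)%E by apply: mball_gt0; lra.
have C0 : 0 < C by exact: expR_gt0.
have [Vf|] := ltP V +oo%E; last first.
  by rewrite leye_eq => /eqP ->; rewrite gt0_muley ?lte_fin// leey.
have fV : V \is a fin_num by rewrite ge0_fin_numE// ltW.
have [A0|A0] := leP (m A) 0%E.
  by apply: (le_trans A0); rewrite mule_ge0// ?lee_fin ltW.
have fA : m A \is a fin_num by rewrite ge0_fin_numE// ltW.
have [d0 d00 md0] := mball_locally_finite w.
(* [d0] makes the tiny ball of finite measure. With [d] and the tolerance [k] at most [r / 24], the
   midpoint radius [d + (d + r) / 2 + k] is at most [29 / 48 * r], below [2 / 3 * r]. *)
pose d := Num.min d0 (r / 24).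
have d_gt0 : 0 < d by rewrite lt_min d00 divr_gt0.
have d_le : d <= r / 24 by rewrite ge_min lexx orbT.
have Df : (m (mball w d) < +oo)%E.
  apply: le_lt_trans md0; apply: le_measure; rewrite ?inE; try exact: mball_measurable.
  by apply: sub_mball; rewrite mdistxx add0r ge_min lexx.
have [mu0 [mu0A E0 P0]] := uniform_probability (mball_measurable w d)
  (mball_gt0 w d_gt0) Df.
have [mu1 [mu1A E1 P1]] := uniform_probability mA A0 Af.
have {}P0 : P2 mu0 by apply: (P0 w d) => x /ltW.
have {}P1 : P2 mu1 by apply: (P1 w r) => x /Aw/ltW.
have D0 : D_Ent m mu0 by split => //; rewrite E0 ltry.
have D1 : D_Ent m mu1 by split => //; rewrite E1 ltry.
have mu1w : mu1 (~` mball w r) = 0%E.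
  apply: subset_measure0 mu1A; try by apply: measurableC => //; exact: mball_measurable.
  exact: subsetC.
have W2L : 0 <= W2 mu0 mu1 <= L.
  rewrite sqrtr_ge0 /=.
  apply: (W2_le sX (mball_measurable w d) (mball_measurable w r) mu0A mu1w); first lra.
  move=> x y wx wy; rewrite /mball /= in wx wy.
  by have := metric_triangle x w y; rewrite (metric_sym x w); lra.
have [mu [[G0 G1 GP GW] _ GU]] := cd D0 D1.
have half : 0 <= (2^-1 : R) <= 1 by apply/andP; split; lra.
have zero : 0 <= (0 : R) <= 1 by rewrite lexx ler01.
have one : 0 <= (1 : R) <= 1 by rewrite lexx ler01.
(* [mu 0] and [mu0] agree on Borel sets only and cannot be exchanged by rewriting; the speed of the
   geodesic between times 0 and 1 gives the equality instead. *)
have W01 : W2 (mu 0) (mu 1) = W2 mu0 mu1.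
  by rewrite GW// sub0r normrN1 mul1r.
have nuw : mu 2^-1 (~` mball w (d + (d + r) / 2 + r / 24)) = 0%E.
  apply: (midpoint_concentration sX (GP _ zero) (GP _ one) (GP _ half) d_gt0 r0) => //.
  - by rewrite divr_gt0.
  - by apply: etrans (G0 _ _) mu0A; apply: measurableC; exact: mball_measurable.
  - by apply: etrans (G1 _ _) mu1w; apply: measurableC; exact: mball_measurable.
  - by rewrite GW// W01 sub0r normrN ger0_norm ?invr_ge0// mulrC.
  - by rewrite GW// W01 (_ : 2^-1 - 1 = - 2^-1) ?normrN ?ger0_norm ?invr_ge0// 1?mulrC//; lra.
set nu := mu 2^-1 in nuw.
have {}nuw : nu (~` mball w (2 / 3 * r)) = 0%E.
  apply: subset_measure0 nuw; try by apply: measurableC => //; exact: mball_measurable.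
  by apply: subsetC; apply: sub_mball; rewrite mdistxx; lra.
have N0 : 0 < N := lt_le_trans ltr01 N1.
have v0 : 0 < fine V by rewrite fine_gt0// V0.
have Ule : (U_ m N nu <= (expR (N^-1 * ln (fine V)))%:E)%E.
  by apply: (U_le N0 (mball_measurable w (2 / 3 * r)) nuw v0); rewrite fineK.
have := GU _ half; rewrite (_ : 1 - 2^-1 = 2^-1); last lra.
have sg := sigma_half_ge K N1 W2L.
have sg0 : (0 <= sigma K N (2^-1)%R (W2 mu0 mu1))%E.
  by apply: le_trans sg; rewrite lee_fin expR_ge0.
move=> {}GU.
(* Brunn-Minkowski in the form [c * m(A)^(1/N) <= V^(1/N)], with [c] the lower bound for the
   distortion coefficient; taking [N]-th powers produces [C = c^(-N)]. *)
have : ((expR (- (L * Num.sqrt (`|K| / N) + 1)))%:E * (expR (N^-1 * ln (fine (m A))))%:E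
    <= (expR (N^-1 * ln (fine V)))%:E)%E.
  apply: le_trans Ule; apply: le_trans GU.
  rewrite -(U_uniform N E1) -[leLHS]add0e; apply: leeD.
    by rewrite mule_ge0// expeR_ge0.
  by apply: lee_wpmul2r => //; exact: expeR_ge0.
rewrite -EFinM lee_fin -expRD ler_expR => H.
have a0 : 0 < fine (m A) by rewrite fine_gt0// A0.
rewrite -(fineK fA) -(fineK fV) -EFinM lee_fin.
rewrite -[fine (m A)]lnK ?posrE// -[X in _ <= C * X]lnK ?posrE// -expRD ler_expR.
have : N * (N^-1 * ln (fine (m A))) <=
       N * (L * Num.sqrt (`|K| / N) + 1 + N^-1 * ln (fine V)).
  by rewrite ler_pM2l//; lra.
by rewrite mulrDr !mulrA !divff ?gt_eqF// !mul1r.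
Qed.

(** [CDe_ball] cannot take the ball itself as [A], whose measure is not yet known to be finite.
    Compact subsets have finite measure, and inner regularity passes to the supremum. *)
Lemma mball_two_thirds (L : R) (w : X) (r : R) : 0 < r -> 2 * r <= L ->
  (m (mball w r) <=
   (expR (N * (L * Num.sqrt (`|K| / N) + 1)))%:E * m (mball w (2 / 3 * r)))%E.
Proof.
move=> r0 rL; case: mm => _ _ [_ inner] _.
rewrite inner; last exact: mball_measurable.
apply: ge_ereal_sup => _ [A [cA Aw] <-]; apply: CDe_ball => //.
- by apply: borel_closed; exact: compact_closed (@metric_hausdorff R X) cA.
- exact: compact_measure_lty.
Qed.

Lemma mball_iter (L : R) k : exists2 C : R, 0 < C & forall (w : X) (r : R),
  0 < r -> 2 * r <= L -> (m (mball w r) <= C%:E * m (mball w ((2 / 3) ^+ k * r)))%E.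
Proof.
elim: k => [|k [C C0 IH]].
  by exists 1 => // w r r0 rL; rewrite mul1e expr0 mul1r.
exists (C * expR (N * (L * Num.sqrt (`|K| / N) + 1))).
  by rewrite mulr_gt0// expR_gt0.
move=> w r r0 rL; apply: le_trans (IH w r r0 rL) _.
rewrite EFinM -muleA exprS -mulrA.
apply: lee_wpmul2l; first by rewrite lee_fin ltW.
have p0 : 0 < (2 / 3 : R) ^+ k by rewrite exprn_gt0.
have p1 : (2 / 3 : R) ^+ k <= 1 by rewrite exprn_ile1//; lra.
apply: mball_two_thirds; first by rewrite mulr_gt0.
by apply: le_trans rL; rewrite ler_pM2l//; rewrite ger_pMl.
Qed.

Lemma mball_compare (r e : R) : 0 < r -> 0 < e -> exists2 C : R, 0 < C &
  forall w : X, (m (mball w r) <= C%:E * m (mball w e))%E.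
Proof.
move=> r0 e0.
have [k kP] : exists k, (2 / 3 : R) ^+ k < e / r.
  have : (fun k => (2 / 3 : R) ^+ k) @ \oo --> (0 : R).
    by apply: cvg_expr; rewrite ger0_norm; lra.
  move=> /cvgr_lt /(_ (e / r)) /(_ (divr_gt0 e0 r0)) /filter_ex[k kP]; exists k; exact: kP.
have [C C0 CP] := mball_iter (2 * r) k; exists C => // w.
apply: le_trans (CP w r r0 (lexx _)) _; apply: lee_wpmul2l; first by rewrite lee_fin ltW.
apply: le_measure; rewrite ?inE; try exact: mball_measurable.
apply: sub_mball; rewrite mdistxx add0r.
by rewrite -ler_pdivlMr// ltW.
Qed.

(** Local finiteness gives one small ball of finite measure around [w], and doubling bounds all
    larger ones by it. *)
Lemma mball_lty (w : X) (r : R) : (m (mball w r) < +oo)%E.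
Proof.
have [e e0 me] := mball_locally_finite w.
have r10 : 0 < `|r| + 1 by rewrite ltr_wpDl.
have [C C0 CP] := mball_compare r10 e0.
apply: (@le_lt_trans _ _ (m (mball w (`|r| + 1)))).
  apply: le_measure; rewrite ?inE; try exact: mball_measurable.
  by apply: sub_mball; rewrite mdistxx add0r; have := ler_norm r; lra.
apply: le_lt_trans (CP w) _.
by rewrite lte_mul_pinfty// lee_fin ltW.
Qed.

Lemma mball_fin_num (w : X) (r : R) : m (mball w r) \is a fin_num.
Proof. by rewrite ge0_fin_numE// mball_lty. Qed.

(** Packing: the balls [B(x, e / 2)] are disjoint inside [B(x0, r + e)], and each carries at least a
    fixed share of [m (B(x0, r))], since [B(x, 2 r)] contains [B(x0, r)]. *)
Lemma separated_bound (x0 : X) (r e : R) : 0 < r -> 0 < e -> exists n : nat,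
  forall s : seq X, pairwise (fun x y => e <= mdist x y) s ->
    (forall x, x \in s -> mball x0 r x) -> (size s <= n)%N.
Proof.
move=> r0 e0.
have [||D D0 DP] := @mball_compare (2 * r) (e / 2); [lra|lra|].
pose v1 := fine (m (mball x0 r)); pose v2 := fine (m (mball x0 (r + e))).
have v10 : 0 < v1 by rewrite fine_gt0// mball_lty mball_gt0.
have v20 : 0 <= v2 by exact: fine_ge0.
exists (Num.bound (D * v2 / v1)) => s ps sr.
pose a x := fine (m (mball x (e / 2))).
have sa : \sum_(x <- s) a x <= v2.
  rewrite -lee_fin -sumEFin fineK ?mball_fin_num//.
  rewrite (eq_bigr (fun x => m (mball x (e / 2)))); last first.
    by move=> x _; rewrite fineK ?mball_fin_num.
  apply: sum_disjoint_le_measure.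
  - exact: mball_measurable.
  - by move=> x; exact: mball_measurable.
  - apply: sub_pairwise ps => x y exy; apply/asboolP/seteqP; split => // z [xz yz].
    rewrite /mball/= in xz yz; exfalso.
    by have := metric_triangle x z y; rewrite (metric_sym z y); lra.
  - move=> x /sr; rewrite /mball/= => xr; apply: sub_mball; lra.
have va x : x \in s -> v1 <= D * a x.
  move=> /sr; rewrite /mball/= => xr.
  rewrite -lee_fin EFinM !fineK ?mball_fin_num//; apply: le_trans (DP x).
  apply: le_measure; rewrite ?inE; try exact: mball_measurable.
  by apply: sub_mball; rewrite (metric_sym x); lra.
have sv : (size s)%:R * v1 <= D * v2.
  apply: (@le_trans _ _ (\sum_(x <- s) D * a x)).
    have -> : (size s)%:R * v1 = \sum_(x <- s) v1.
      by rewrite big_const_seq count_predT iter_addr_0 mulr_natl.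
    rewrite big_seq [leRHS]big_seq.
    by apply: ler_sum => x xs; exact: va.
  by rewrite -mulr_sumr ler_pM2l.
have b0 : 0 <= D * v2 / v1 by rewrite divr_ge0 ?mulr_ge0// ltW.
have := archi_boundP b0; rewrite -(ltr_pM2r v10) divfK ?gt_eqF// => /(le_lt_trans sv).
by rewrite ltr_pM2r// ltr_nat => /ltnW.
Qed.

Lemma closed_mball_compact (x : X) (r : R) : compact [set y | mdist x y <= r].
Proof.
apply: complete_totally_bounded_compact; first exact: closed_mball.
move=> e e0; have r10 : 0 < `|r| + 1 by rewrite ltr_wpDl.
have [n nP] := separated_bound x r10 e0.
have [|s [_ _ sP]] := @separated_cover R X [set y | mdist x y <= r] e n.
  move=> s ps sr; apply: nP => // y /sr /=; rewrite /mball/=.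
  by have := ler_norm r; lra.
by exists s.
Qed.

(* For a maximal [3 s]-separated family [z] in [E], the holes [B(w z, s / 2)] are
   disjoint and lie in the [2 s]-neighbourhood of [E] minus [E], whose measure
   tends to 0, while the balls [B(z, 3 s)] cover [E]. *)
Lemma porous_bounded_null (E : set X) (x0 : X) (r s0 : R) : 0 < s0 -> closed E ->
  E `<=` mball x0 r ->
  (forall (z : X) (s : R), E z -> 0 < s < s0 -> exists2 w, mdist z w <= s &
     forall c, E c -> s / 2 <= mdist w c) ->
  m E = 0%E.
Proof.
move=> s00 cE Er porous.
have mE : measurable (E : set (borel X)) by exact: borel_closed.
have r10 : 0 < `|r| + 1 by rewrite ltr_wpDl.
have {}Er : E `<=` mball x0 (`|r| + 1).
  by move=> y /Er; rewrite /mball/=; have := ler_norm r; lra.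
(* A ball of radius [4 s] is compared with one of radius [s / 2]: 6 is the least exponent with
   [(2 / 3)^6 <= 1 / 8], and [2 * (4 s) <= 8] for [s <= 1]. *)
have [D D0 DP] := mball_iter 8 6.
pose A (s : R) : set (borel X) := (\bigcup_(z in E) mball z s) `\` E.
have mA s : measurable (A s).
  apply: measurableD => //; apply: borel_open; apply: bigcup_open => z _; exact: open_mball.
have EA s : 0 < s -> s < s0 -> s <= 1 -> (m E <= D%:E * m (A (2 * s)%R))%E.
  move=> sp ss s1.
  have [n nP] := separated_bound x0 r10 (mulr_gt0 (ltr0n R 3) sp).
  have [|t [pt tE tcov]] := @separated_cover R X E (3 * s) n.
    by move=> t pt tE; apply: nP => // x /tE /Er.
  have /choice[w wP] (z : X) : exists w : X, E z -> mdist z w <= s /\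
      forall c, E c -> s / 2 <= mdist w c.
    have [Ez|] := pselect (E z); last by exists z.
    have [|w zw wc] := porous z s Ez; first by rewrite sp.
    by exists w.
  apply: (@le_trans _ _ (\sum_(z <- t) m (mball z (3 * s)))%E).
    apply: measure_le_sum_cover => //.
    by move=> z; exact: mball_measurable.
  apply: (@le_trans _ _ (\sum_(z <- t) D%:E * m (mball (w z) (s / 2)))%E).
    rewrite big_seq [leRHS]big_seq; apply: lee_sum => z zt.
    have [zw _] := wP z (tE _ zt).
    apply: (@le_trans _ _ (m (mball (w z) (4 * s)))).
      apply: le_measure; rewrite ?inE; try exact: mball_measurable.
      by apply: sub_mball; rewrite metric_sym; lra.
    apply: le_trans (DP _ _ _ _) _; [lra|lra|].
    apply: lee_wpmul2l; first by rewrite lee_fin ltW.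
    apply: le_measure; rewrite ?inE; try exact: mball_measurable.
    by apply: sub_mball; rewrite mdistxx; lra.
  rewrite -ge0_sume_distrr//; apply: lee_wpmul2l; first by rewrite lee_fin ltW.
  apply: sum_disjoint_le_measure => //.
  - by move=> z; exact: mball_measurable.
  - apply: (sub_in_pairwise (P := mem t) _ (allss t) pt) => x y xt yt xy.
    apply/asboolP/seteqP; split => // z [xz yz].
    have [xw _] := wP _ (tE _ xt); have [yw _] := wP _ (tE _ yt).
    rewrite /mball/= in xz yz; exfalso.
    have := metric_triangle x (w x) y; have := metric_triangle (w x) z y.
    have := metric_triangle z (w y) y.
    by rewrite (metric_sym z (w y)) (metric_sym (w y) y); lra.
  - move=> z zt y; rewrite /mball/= => wy; have [zw wE] := wP _ (tE _ zt); split.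
      by exists z; [exact: tE|rewrite /mball/=; have := metric_triangle z (w z) y; lra].
    by move=> /wE; rewrite leNgt; apply/negP/negPn; lra.
pose s1 := Num.min (s0 / 2) 1.
have s10 : 0 < s1 by rewrite lt_min divr_gt0 ?ltr01.
have s11 : s1 <= 1 by rewrite ge_min lexx orbT.
have s1s : s1 < s0 by rewrite gt_min; apply/orP; left; lra.
pose u (n : nat) := s1 / n.+1%:R.
have u0 n : 0 < u n by rewrite divr_gt0.
have u1 n : u n <= s1 by rewrite ler_pdivrMr//; apply: ler_peMr; [exact: ltW|rewrite ler1n].
pose F n := A (2 * u n).
(* Continuity from above needs one set of finite measure, which boundedness of [E] provides;
   closedness of [E] then makes the intersection empty. *)
have F0 : (m (F 0%N) < +oo)%E.
  apply: le_lt_trans (mball_lty x0 (`|r| + 1 + 2)).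
  apply: le_measure; rewrite ?inE; [exact: mA|exact: mball_measurable|].
  move=> y [[z /Er Ez zy] _]; rewrite /mball/= in Ez zy *.
  by have := metric_triangle x0 z y; have := u1 0%N; lra.
have FE : \bigcap_n F n = set0.
  apply/seteqP; split => // y Fy; have [_ Ey] := Fy 0%N Logic.I.
  have : nbhs y (~` E) by apply: open_nbhs_nbhs; split => //; exact: closed_openC.
  move=> /metricType_numDomainType.nbhs_mdistP[e /= e0 eE].
  pose n := Num.bound (2 * s1 / e).
  have [[z Ez zy] _] := Fy n Logic.I.
  apply: (eE z) => //=; rewrite metric_sym; apply: lt_trans zy _.
  rewrite /u mulrA ltr_pdivrMr// [e * _]mulrC -ltr_pdivrMr//.
  have /archi_boundP : 0 <= 2 * s1 / e by rewrite divr_ge0 ?mulr_ge0// ltW.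
  by move=> /lt_trans; apply; rewrite ltr_nat.
have Fni : nonincreasing_seq F.
  move=> i j ij; apply/subsetPset => y [[z Ez zy] Ey]; split => //.
  exists z => //; rewrite /mball/= in zy *; apply: lt_le_trans zy _.
  rewrite ler_pM2l// /u ler_pM2l// lef_pV2 ?posrE//.
  by rewrite ler_nat.
have := nonincreasing_cvg_mu F0 (fun n => mA _) _ Fni.
rewrite FE measure0 => /(_ measurable0) cv.
have cvD : (D%:E * (m \o F) n)%E @[n --> \oo] --> (D%:E * 0)%E by exact: cvgeZl.
apply/eqP; rewrite eq_le measure_ge0 andbT -[leRHS](mule0 D%:E).
apply: cvge_ge cvD; apply: nearW => n; apply: EA => //; last exact: le_trans s11.
exact: le_lt_trans s1s.
Qed.

(** Bounded pieces of [E] inherit its holes, since a point far from [E] is far from every subset. *)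
Lemma porous_null (E : set X) (s0 : R) : 0 < s0 -> closed E ->
  (forall (z : X) (s : R), E z -> 0 < s < s0 -> exists2 w, mdist z w <= s &
     forall c, E c -> s / 2 <= mdist w c) ->
  m E = 0%E.
Proof.
move=> s00 cE porous.
have mE : measurable (E : set (borel X)) by exact: borel_closed.
pose F (n : nat) : set (borel X) := E `&` [set y | mdist (point : X) y <= n%:R].
have cF n : closed (F n : set X) by apply: closedI => //; exact: closed_mball.
have -> : E = \bigcup_n F n.
  apply/seteqP; split => [y Ey|y [n _ []]//].
  exists (Num.bound (mdist point y)) => //; split => //=.
  by apply/ltW/archi_boundP; exact: mdist_ge0.
apply/negligibleP; first by apply: bigcupT_measurable => n; exact: borel_closed.
apply: negligible_bigcup => n; apply/negligibleP; first exact: borel_closed.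
apply: (@porous_bounded_null (F n) point (n%:R + 1) s0) => //.
  by move=> y [_ /= yn]; rewrite /mball/=; lra.
by move=> z s [Ez _] ss; have [w zw wE] := porous z s Ez ss; exists w => // c [/wE].
Qed.
End doubling.

(** * Porosity of an orbit that misses a point *)

Theorem proposition5p10 (R : realType) (K N : R) (hN : 1 <= N)
    (X : completeMetricType R) (m : {measure set (borel X) -> \bar R})
    (hRCD : RCD_star K N m)
    (G : set {compact-open, X -> X}) (hG : closed_subgroup_Iso G)
    (p : X) (hp : (0 < m (orbit_of G p))%E) :
  orbit_of G p = [set: X].
Proof.
case: hRCD => mm cd _.
have cO : closed (orbit_of G p).
  by apply: orbit_closed hG => x r; exact: (closed_mball_compact hN mm cd).
have [[GI G1 GM GV] _] := hG.
apply/seteqP; split => // y0 _; apply: contrapT => ny0.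
suff : m (orbit_of G p) = 0%E by move=> m0; rewrite m0 ltxx in hp.
set O := orbit_of G p in cO ny0 *.
pose S := [set mdist y0 c | c in O].
have Op : O p by exists idfun.
have S0 : S !=set0 by exists (mdist y0 p), p.
have [e e0 eO] : exists2 e : R, 0 < e & forall c, O c -> e <= mdist y0 c.
  have : nbhs y0 (~` O) by apply: open_nbhs_nbhs; split => //; exact: closed_openC.
  move=> /metricType_numDomainType.nbhs_mdistP[e /= e0 eE]; exists e => // c Oc.
  by rewrite leNgt; apply/negP => /eE; apply.
have infS : has_inf S by split => //; exists e => _ [c Oc <-]; exact: eO.
pose r := inf S.
have r0 : 0 < r by apply: lt_le_trans e0 _; apply: lb_le_inf => // _ [c Oc <-]; exact: eO.
have rO c : O c -> r <= mdist y0 c.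
  by move=> Oc; apply: ge_inf; [exact: infS.2|exists c].
(* Scales below [r] leave room on the geodesic used later, which has length at least [r]. *)
apply: (porous_null hN mm cd r0 cO) => z s Oz /andP[s0 sr].
have [_ [c Oc <-] cr] := inf_adherent (divr_gt0 s0 (ltr0n R 2)) infS.
rewrite -/r in cr.
(* Only [c] is known to be almost nearest to [y0]. Moving it to [z] makes [z] almost nearest to
   [g y0], which is still at distance at least [r] from the [G]-invariant orbit. *)
have [g [Gg gc]] : exists g : X -> X, G g /\ g c = z.
  case: Oz => g1 G1' <-; case: Oc cr => g2 G2' <- _.
  have [[j gj jg] _] := GI _ G2'.
  exists (g1 \o j); split; first by apply: GM => //; exact: GV G2' gj.
  by rewrite /= gj.
have giso a b : mdist (g a) (g b) = mdist a b by have [_ ->] := GI _ Gg.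
have gO c' : O c' -> r <= mdist (g y0) c'.
  have [[j gj jg] _] := GI _ Gg.
  case=> g' Gg' <-; rewrite -[g' p]jg giso; apply: rO.
  by exists (j \o g') => //; apply: GM => //; exact: GV Gg gj.
have d_r : mdist z (g y0) < r + s / 2 by rewrite -gc giso metric_sym.
have d_r' : r <= mdist z (g y0) by rewrite metric_sym; exact: gO.
(* On a geodesic from [z] to [g y0], the point at distance [s] from [z] is at distance
   [d - s < r - s / 2] from [g y0], hence more than [s / 2] away from the orbit. *)
case: mm => _ /(_ z (g y0))[gam [gam0 gam1 gamP]] _ _.
set d := mdist z (g y0) in d_r d_r' gamP.
have d0 : 0 < d by exact: lt_le_trans d_r'.
have t01 : 0 <= s / d <= 1.
  by rewrite divr_ge0 ?(ltW s0) ?(ltW d0)//= ler_pdivrMr// mul1r; lra.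
have i0 : 0 <= (0 : R) <= 1 by rewrite lexx ler01.
have i1 : 0 <= (1 : R) <= 1 by rewrite lexx ler01.
have sd : s / d * d = s by rewrite divfK// gt_eqF.
exists (gam (s / d)).
  by rewrite -gam0 gamP// sub0r normrN ger0_norm ?sd//; case/andP: t01.
move=> c' Oc'; have := gO _ Oc'.
have := metric_triangle (g y0) (gam (s / d)) c'.
rewrite -gam1 gamP// ger0_norm; last by rewrite subr_ge0; case/andP: t01.
by rewrite mulrBl mul1r sd; lra.
Qed.
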